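(* Let $G$ be a Lie group, $T>0$, $g_0\in G$, $C:G\to\mathbb R$ a terminal cost function, and $F(\cdot,u)$ a vector field on $G$ depending on a parameter $u\in U$, with left-trivialization $f(g,u)=g^{-1}\cdot F(g,u)\in\mathfrak g$. For $u\in U$ let $g:[0,T]\to G$ be the solution of $\dot g(t)=F(g(t),u)$, $g(0)=g_0$, where $g_0$ is independent of $u$, and regard $C(g(T))$ as a function of $u$. Then the parameter sensitivity, i.e. the derivative of $C(g(T))$ with respect to $u$, is given by $$\frac{d}{du}C(g(T))=\frac{d}{du}J=\int_0^T\Big\langle\mu,\frac{\partial}{\partial u}f(g,u)\Big\rangle dt,$$ where $J=C(g(T))-\int_0^T\langle\mu,\xi-f(g,u)\rangle\,dt$, $\xi=g^{-1}\cdot\dot g$, and $\mu:[0,T]\to\mathfrak g^*$ is chosen to satisfy the adjoint equation $$-\dot\mu+\mathrm{ad}^*_\xi\mu-g^*\cdot[D_gf(g,u)]^*\mu=0$$ and the terminal condition $\mu(T)=g(T)^*\cdot dC(g(T))$.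
   Context: $C$ is smooth; $F$ is smooth in $g$ and continuously differentiable with respect to the parameter $u$ (jointly $C^1$ in $(g,u)$, so that the solution depends differentiably on $u$), and the solution $g$ is assumed to exist on $[0,T]$ for the parameters considered. The parameter set $U$ is a vector space or a manifold; the identity is one of covectors on $T_uU$ (i.e. it holds when both sides are evaluated on any $\delta u\in T_uU$). $\langle\cdot,\cdot\rangle$ is the duality pairing between $T_g^*G$ and $T_gG$ (in particular between $\mathfrak g^*$ and $\mathfrak g=T_eG$). With $L_g(x)=gx$: $g^{-1}\cdot v_g:=T_gL_{g^{-1}}(v_g)\in\mathfrak g$ for $v_g\in T_gG$, and $g^*\cdot p_g:=T_e^*L_g(p_g)\in\mathfrak g^*$ (dual of $T_eL_g$) for $p_g\in T_g^*G$. $D_gf(g,u):T_gG\to\mathfrak g$ is the derivative of $f$ in $g$ with $u$ fixed, $[D_gf(g,u)]^*:\mathfrak g^*\to T_g^*G$ its dual, and $\frac{\partial}{\partial u}f(g,u)$ the derivative in $u$ with $g$ fixed. $\mathrm{ad}_\xi\eta=[\xi,\eta]$, and $\langle\mathrm{ad}_\xi^*\mu,\eta\rangle=\langle\mu,\mathrm{ad}_\xi\eta\rangle$. In computing $\frac{d}{du}J$, the curve $g$ (hence $\xi$) varies with $u$ as the solution of the ODE; the term $\xi-f(g,u)$ vanishes along it. *)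

(* Defs.v *)
From HB Require Import structures.
From mathcomp Require Import all_boot all_order all_algebra.
From mathcomp Require Import all_classical all_reals all_analysis.

Set Implicit Arguments.
Unset Strict Implicit.
Unset Printing Implicit Defensive.
Import Order.TTheory GRing.Theory Num.Theory.
Import numFieldNormedType.Exports.

Local Open Scope classical_set_scope.
Local Open Scope ring_scope.

(* C^k on the open set O, through iterated tangent maps (x, v) |-> 'd f x v.
   For finite-dimensional V this is the usual C^k.  For infinite-dimensional V
   the requirement at a fixed k is slightly weaker than Fréchet-C^k, but having
   it for all k is equivalent to Fréchet smoothness. *)
Fixpoint Ck (k : nat) (R : realType) (V W : normedModType R) (O : set V)
    (f : V -> W) : Prop :=
  if k is k'.+1 then
    (forall x, O x -> differentiable f x) /\
    @Ck k' R (V * V)%type W (O `*` setT) (fun p => 'd f (p.1) (p.2))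
  else forall x, O x -> {for x, continuous f}.

Definition smooth_on (R : realType) (V W : normedModType R) (O : set V)
  (f : V -> W) : Prop := forall k, Ck k O f.

Definition smooth_near (R : realType) (V W : normedModType R) (f : V -> W)
  (x : V) : Prop := exists2 O, open_nbhs x O & smooth_on O f.

(* Fréchet differentiable near x, with differential continuous at x for the
   operator norm. *)
Definition C1_at (R : realType) (V W : normedModType R) (f : V -> W) (x : V) :=
  (\forall y \near x, differentiable f y) /\
  (forall e : R, 0 < e ->
     \forall y \near x, forall v, `|'d f y v - 'd f x v| <= e * `|v|).

(* A smooth Hausdorff manifold modelled on the normed space E.  The atlas is
   indexed by the points: [chart x] is a chart around x, with domain
   [chart_dom x] and inverse [chart_inv x]; both are total functions whose
   values outside chart_dom x and its image are irrelevant. *)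
HB.mixin Record isManifold (R : realType) (E : normedModType R) (M : Type)
    of Topological M := {
  manifold_hausdorff : hausdorff_space M;
  chart_dom : M -> set M;
  chart : M -> M -> E;
  chart_inv : M -> E -> M;
  chart_dom_open : forall x, open (chart_dom x);
  chart_dom_center : forall x, chart_dom x x;
  chart_codom_open : forall x, open (chart x @` chart_dom x);
  chartK : forall x y, chart_dom x y -> chart_inv x (chart x y) = y;
  chart_continuous : forall x y, chart_dom x y ->
    {for y, continuous (chart x)};
  chart_inv_continuous : forall x z, (chart x @` chart_dom x) z ->
    {for z, continuous (chart_inv x)};
  chart_transition : forall x y,
    smooth_on (chart x @` (chart_dom x `&` chart_dom y))
              (chart y \o chart_inv x)
}.

#[short(type="manifoldType")]
HB.structure Definition Manifold (R : realType) (E : normedModType R) :=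
  {M of isManifold R E M & Topological M}.

(* A tangent vector at x is represented by its components in the chart
   [chart x]; in particular all tangent spaces are convertible to E, and the
   base point is what tells in which chart a vector has to be read. *)
Definition tangent (R : realType) (E : normedModType R) (M : manifoldType E)
  (x : M) : normedModType R := E.

Section Calculus.
Variables (R : realType) (E : normedModType R) (M : manifoldType E).

Definition mdifferentiable (W : normedModType R) (f : M -> W) (x : M) :=
  differentiable (f \o chart_inv x) (chart x x).

Definition mdiff (W : normedModType R) (f : M -> W) (x : M) :
  {linear tangent x -> W} := 'd (f \o chart_inv x) (chart x x).

Definition smooth_fun (W : normedModType R) (f : M -> W) :=
  forall x, smooth_near (f \o chart_inv x) (chart x x).

(* The representation, in the chart around x0, of a vector field X. *)
Definition vf_rep (X : forall x : M, tangent x) (x0 : M) (z : E) : E :=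
  let x := chart_inv x0 z in mdiff (chart x0) x (X x).

Definition smooth_vf (X : forall x : M, tangent x) :=
  forall x0, smooth_on (chart x0 @` chart_dom x0) (vf_rep X x0).

(* [X, Y]^i = X(Y^i) - Y(X^i), computed in the chart around x. *)
Definition lie_bracket (X Y : forall x : M, tangent x) (x : M) : tangent x :=
  'd (vf_rep Y x) (chart x x) (X x) - 'd (vf_rep X x) (chart x x) (Y x).

Definition covector (x : M) := {linear tangent x -> R^o}.

End Calculus.

(* The tangent map at x of a map f that is continuous at x. *)
Definition tangent_map (R : realType) (E E' : normedModType R)
    (M : manifoldType E) (N : manifoldType E') (f : M -> N) (x : M) :
    {linear tangent x -> tangent (f x)} :=
  mdiff (chart (f x) \o f) x.

(* The dual p |-> p \o A of a linear map A; it is linear in v whenever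
   A and p are. *)
Definition dual (R : realType) (V W : normedModType R) (A : V -> W)
  (p : W -> R) : V -> R := fun v => p (A v).

(* A parameter-dependent vector field F(., u), jointly C^1 on M x U. *)
Definition C1_vf (R : realType) (E V : normedModType R) (M : manifoldType E)
    (U : manifoldType V) (F : forall x : M, U -> tangent x) : Prop :=
  forall (x0 : M) (u0 : U),
    C1_at (fun p : E * V => vf_rep (fun x => F x (chart_inv u0 p.2)) x0 p.1)
          (chart x0 x0, chart u0 u0).

(* Derivatives of curves defined on a subset D of R, through difference
   quotients in D; with D = [0, T] they are one-sided at 0 and T. *)
Section Curves.
Variables (R : realType) (D : set R).

Definition diff_quot (W : normedModType R) (c : R -> W) (t s : R) : W :=
  (s - t)^-1 *: (c s - c t).

Definition derivable_within (W : normedModType R) (c : R -> W) (t : R) :=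
  cvg (diff_quot c t @ within D t^').

Definition derive_within (W : normedModType R) (c : R -> W) (t : R) : W :=
  lim (diff_quot c t @ within D t^').

Variables (E : normedModType R) (M : manifoldType E).

Definition curve_derivable (c : R -> M) (t : R) :=
  c @ within D (nbhs t) --> c t /\ derivable_within (chart (c t) \o c) t.

Definition velocity (c : R -> M) (t : R) : tangent (c t) :=
  derive_within (chart (c t) \o c) t.

End Curves.

Definition is_solution (R : realType) (E V : normedModType R)
    (M : manifoldType E) (U : manifoldType V)
    (F : forall x : M, U -> tangent x) (u : U) (x0 : M) (T : R) (c : R -> M) :=
  c 0 = x0 /\
  forall t, t \in `[0, T] ->
    curve_derivable `[0, T] c t /\ velocity `[0, T] c t = F (c t) u.

HB.mixin Record isLieGroup (R : realType) (n : nat) (G : Type)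
    of Manifold R 'rV[R]_n G & Group G := {
  lie_mul_continuous : continuous (fun p : G * G => (p.1 * p.2)%g);
  lie_mul_smooth : forall a b : G,
    smooth_near
      (fun z : 'rV[R]_n * 'rV[R]_n =>
         chart (a * b)%g (chart_inv a z.1 * chart_inv b z.2)%g)
      (chart a a, chart b b);
  lie_inv_continuous : continuous (fun a : G => a^-1%g);
  lie_inv_smooth : forall a : G,
    smooth_near (chart a^-1%g \o (fun x : G => x^-1%g) \o chart_inv a)
                (chart a a)
}.

#[short(type="lieGroupType")]
HB.structure Definition LieGroup (R : realType) (n : nat) :=
  {G of isLieGroup R n G & Manifold R 'rV[R]_n G & Group G}.

Section LieGroupTheory.
Variables (R : realType) (n : nat) (G : lieGroupType R n).
Implicit Types (g : G).

Definition lie_algebra := tangent (1%g : G).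

(* T_e L_g; its codomain is the tangent space at g * 1 = g. *)
Definition TL g : lie_algebra -> tangent g := tangent_map (fun x : G => g * x)%g 1%g.

(* g^-1 . v for v in T_g G; the codomain of the tangent map is the tangent
   space at g^-1 * g = 1. *)
Definition left_triv g (v : tangent g) : lie_algebra :=
  tangent_map (fun x : G => g^-1 * x)%g g v.

(* g^* . p for p in T_g^* G *)
Definition cotranslate g (p : tangent g -> R) : lie_algebra -> R :=
  dual (TL g) p.

(* The Lie bracket of left-invariant vector fields. *)
Definition ad (xi eta : lie_algebra) : lie_algebra :=
  lie_bracket (fun g => TL g xi) (fun g => TL g eta) 1%g.

Definition ad_star (xi : lie_algebra) (nu : lie_algebra -> R) :
  lie_algebra -> R := dual (ad xi) nu.

Variables (V : normedModType R) (U : manifoldType V).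
Variable F : forall g : G, U -> tangent g.

Definition triv_vf g (u : U) : lie_algebra := left_triv (F g u).

Definition body_velocity (T : R) (c : R -> G) (t : R) : lie_algebra :=
  left_triv (velocity `[0, T] c t).

(* - mu' + ad^*_xi mu - g^* . [D_g f(g, u)]^* mu = 0 on [0, T], as an identity
   of covectors on the Lie algebra, whose dual is finite-dimensional, so that
   mu' can be computed pointwise. *)
Definition adjoint_equation (T : R) (u : U) (c : R -> G)
    (mu : R -> covector (1%g : G)) :=
  forall t, t \in `[0, T] -> forall eta : lie_algebra,
    derivable_within `[0, T] (fun s => mu s eta) t /\
    - derive_within `[0, T] (fun s => mu s eta) t
    + ad_star (body_velocity T c t) (mu t) eta
    - cotranslate (dual (mdiff (fun g => triv_vf g u) (c t)) (mu t)) eta = 0.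

Definition augmented_cost (C : G -> R^o) (T : R) (mu : R -> covector (1%g : G))
    (u : U) (c : R -> G) : R^o :=
  C (c T) - (\int[lebesgue_measure]_(t in `[0, T])
               mu t (body_velocity T c t - triv_vf (c t) u))%R.

End LieGroupTheory.

(* Main.v *)
From HB Require Import structures.
Require Import Defs.
From mathcomp Require Import all_boot all_order all_algebra.
From mathcomp Require Import all_classical all_reals all_analysis.
From mathcomp Require Import ring lra.

Set Implicit Arguments.
Unset Strict Implicit.
Unset Printing Implicit Defensive.
Import Order.TTheory GRing.Theory Num.Theory.
Import numFieldNormedType.Exports.

Local Open Scope classical_set_scope.
Local Open Scope ring_scope.

(** The derivative of the solution with respect to the parameter is never
    constructed.  Let [c] be the solution at [u] and, for [v] near [u], let
    h_v(t) = c(t)^-1 * g_v(t) be the relative position of the solution at [v].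
    It starts at the identity and can be read in the single chart at the
    identity, as a curve y_v in R^n.  If m is the group law in that chart, then
      y_v' = D_2 m(y_v, e) f(g_v, v) - D_1 m(e, y_v) f(c, u) =: H(t, y_v, v)
    ([relative_curve_derivative]).  H(t, e, u) = 0, and the differential of H at
    (e, u) is
      (eta, dv) |-> D_g f(TL eta) - [xi, eta] + D_u f dv,   xi = f(c, u).
    The bracket appears because the mixed second derivatives of m are symmetric
    ([second_diff_sym], [ad_rep]); see [relative_velocity_diffl] and
    [relative_velocity_diffr].

    The adjoint equation says precisely that mu' is minus the transpose of this
    linearization in eta.  Therefore t |-> mu(t)(y_v(t) - e) has derivative
    mu(D_u f dv) up to an error o(|y_v - e| + |dv|), uniform in t.  A Gronwall
    argument gives |y_v(t) - e| <= K |dv| on [0, T], so integrating yields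
      mu(T)(y_v(T) - e) = int_0^T mu(D_u f dv) dt + o(|dv|)
    ([first_variation]).  Since mu(T) is the differential of z |-> C(c(T) * k(z)),
    where k is the inverse of the chart at the identity, this is the derivative
    of C(g_v(T)) ([adjoint_sensitivity]).  On solutions xi = f, hence
    J = C(g(T)) and the two derivatives agree.

    Two devices keep the estimates uniform in t.  Regularity is used as strict
    differentiability at a point, which is stable under composition and gives
    bounds that hold for all base points near the given one; compactness of
    [0, T] then makes them uniform.  All bounds along a segment (the mean value
    inequality, Gronwall, and the fact that h_v stays in the chart) come from
    [norm_comparison], which is real induction. *)

(** * Real induction, derivatives along a segment, and a comparison principle *)

Lemma subr_interchange (V : zmodType) (a b c d : V) : a - b - (c - d) = a - c - (b - d).
Proof. by rewrite opprD addrACA -opprD. Qed.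

Lemma addr_subr_swap (V : zmodType) (a b c : V) : b + a - c = a - (c - b).
Proof. by rewrite opprB addrCA addrA. Qed.

(** If [P] failed somewhere, the infimum of the failures could neither satisfy
    [P] (it would spread to the right) nor fail it (it holds on the left). *)
Lemma real_induction (R : realType) (T : R) (P : R -> Prop) :
  P 0 ->
  (forall t, 0 < t <= T -> (forall s, 0 <= s < t -> P s) -> P t) ->
  (forall t, 0 <= t < T -> P t -> \forall s \near t, t < s -> s <= T -> P s) ->
  forall t, 0 <= t <= T -> P t.
Proof.
move=> P0 Pclosed Popen t /andP[t0 tT]; apply: contrapT => nPt.
pose S := [set s : R | 0 <= s <= T /\ ~ P s].
have S0 : S !=set0 by exists t; split=> //; apply/andP.
have Slb : has_lbound S by exists 0 => s [/andP[]].
have m0 : 0 <= inf S by apply: lb_le_inf => // s [/andP[]].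
have mt : inf S <= t by apply: ge_inf => //; split=> //; apply/andP.
have below s : 0 <= s < inf S -> P s.
  move=> /andP[s0 sm]; apply: contrapT => nPs.
  suff /(ge_inf Slb) : S s by rewrite leNgt sm.
  by split=> //; rewrite s0 /= (le_trans (ltW sm))// (le_trans mt).
have Pm : P (inf S).
  move: m0; rewrite le_eqVlt => /predU1P[<-//|m0].
  by apply: Pclosed below; rewrite m0 (le_trans mt).
have mT : inf S < T.
  rewrite lt_neqAle (le_trans mt tT) andbT; apply/eqP => mT.
  by apply: nPt; have -> : t = inf S by apply/eqP; rewrite eq_le mt mT tT.
have [|e /= e0 He] := Popen (inf S) _ Pm; first by rewrite m0.
have [s [/andP[s0 sT] nPs] sme] := @inf_adherent _ S e e0 (conj S0 Slb).
have ms : inf S <= s by apply: ge_inf => //; split=> //; apply/andP.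
apply: nPs; move: ms; rewrite le_eqVlt => /predU1P[<-//|ms].
apply: He => //=; rewrite distrC ger0_norm ?subr_ge0 ?(ltW ms)//.
by rewrite ltrBlDl.
Qed.

Lemma nbhs_before (R : realType) (t : R) (P : R -> Prop) :
  0 < t -> (\forall s \near t, P s) -> exists2 s, 0 <= s < t & P s.
Proof.
move=> t0 [d /= d0 Hd]; exists (Num.max 0 (t - d / 2)).
  by rewrite le_max lexx/= gt_max t0/= ltrBlDr ltrDl divr_gt0.
have [mt tm] : Num.max 0 (t - d / 2) < t /\ t - d / 2 <= Num.max 0 (t - d / 2).
  by rewrite le_max lexx orbT gt_max t0/= ltrBlDr ltrDl divr_gt0.
apply: Hd; rewrite /= gtr0_norm ?subr_gt0//; lra.
Qed.

(** Stated by a first-order estimate instead of a limit of difference quotients: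
    the estimate can be composed with maps and intersected with other estimates
    without dividing by [s - t], and needs no case split at [s = t]. *)
Definition has_derive_within (R : realType) (W : normedModType R) (D : set R)
    (c : R -> W) (t : R) (l : W) :=
  forall e : R, 0 < e ->
    \forall s \near t, D s -> `|c s - c t - (s - t) *: l| <= e * `|s - t|.

Section DeriveWithin.
Context {R : realType} {W : normedModType R}.
Implicit Types (D : set R) (c : R -> W).

Lemma derive_withinP D c (t : R) :
  derivable_within D c t -> has_derive_within D c t (derive_within D c t).
Proof.
move=> /cvgrPdist_le dc e e0.
have := dc e e0; rewrite !near_withinE; apply: filterS => s /= Hs Ds.
have [->|st] := eqVneq s t; first by rewrite !subrr scale0r subr0 !normr0 mulr0.
have st0 : s - t != 0 by rewrite subr_eq0.
have -> : c s - c t - (s - t) *: derive_within D c t =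
    (s - t) *: (diff_quot c t s - derive_within D c t).
  by rewrite scalerBr /diff_quot scalerA divff// scale1r.
by rewrite normrZ mulrC distrC ler_wpM2r//; exact: Hs.
Qed.

Lemma has_derive_within_continuous D c t l : has_derive_within D c t l ->
  forall e : R, 0 < e -> \forall s \near t, D s -> `|c s - c t| < e.
Proof.
move=> dc e e0; have l0 : 0 < 1 + `|l| by rewrite ltr_pwDl.
near=> s => Ds.
have H1 : `|c s - c t - (s - t) *: l| <= 1 * `|s - t|.
  by move: Ds; near: s; exact: dc.
rewrite (@le_lt_trans _ _ ((1 + `|l|) * `|s - t|))//.
  rewrite -[X in `|X|](subrK ((s - t) *: l)) (le_trans (ler_normD _ _))//.
  by rewrite normrZ mulrDl lerD// mulrC.
rewrite -ltr_pdivlMl// distrC; near: s.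
by apply: nbhsx_ballx; rewrite mulr_gt0 ?invr_gt0.
Unshelve. all: by end_near. Qed.

Lemma has_derive_within_shift D c a t l : has_derive_within D c t l ->
  has_derive_within D (fun s => c s - a) t l.
Proof.
move=> dc e e0; near=> s => Ds.
have -> : c s - a - (c t - a) = c s - c t by rewrite opprB addrA subrK.
by move: Ds; near: s; exact: dc.
Unshelve. all: by end_near. Qed.

Lemma has_derive_withinB D (c1 c2 : R -> W) t l1 l2 :
  has_derive_within D c1 t l1 -> has_derive_within D c2 t l2 ->
  has_derive_within D (fun s => c1 s - c2 s) t (l1 - l2).
Proof.
move=> d1 d2 e e0; near=> s => Ds.
have H1 : `|c1 s - c1 t - (s - t) *: l1| <= e / 2 * `|s - t|.
  by move: Ds; near: s; apply: d1; rewrite divr_gt0.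
have H2 : `|c2 s - c2 t - (s - t) *: l2| <= e / 2 * `|s - t|.
  by move: Ds; near: s; apply: d2; rewrite divr_gt0.
have -> : c1 s - c2 s - (c1 t - c2 t) - (s - t) *: (l1 - l2) =
    (c1 s - c1 t - (s - t) *: l1) - (c2 s - c2 t - (s - t) *: l2).
  by rewrite scalerBr (subr_interchange (c1 s)) (subr_interchange (c1 s - c1 t)).
rewrite (le_trans (ler_normB _ _))// [e in leRHS]splitr mulrDl.
exact: lerD.
Unshelve. all: by end_near. Qed.

End DeriveWithin.

Section DiffEstimate.
Context {R : realType} {V W : normedModType R}.

Lemma diff_le (f : V -> W) x : differentiable f x -> forall e : R, 0 < e ->
  \forall y \near x, `|f y - f x - 'd f x (y - x)| <= e * `|y - x|.
Proof.
move=> /diff_locally /eqaddoP H e e0; rewrite (near_shift 0) subr0.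
by move: (H e e0); apply: filterS => y; rewrite !fctE /= opprD addrA addrK.
Qed.

Lemma is_diff_le (f : V -> W) x (L : {linear V -> W}) : continuous L ->
  (forall e : R, 0 < e ->
    \forall y \near x, `|f y - f x - L (y - x)| <= e * `|y - x|) ->
  is_diff x f L.
Proof.
move=> Lc HL.
have H : f \o shift x = cst (f x) + L +o_ 0 id.
  apply/eqaddoP => e e0; move: (HL e e0); rewrite (near_shift 0) subr0.
  by apply: filterS => y; rewrite !fctE /= opprD addrA addrK.
have E := diff_unique Lc H.
by apply: DiffDef => //; apply/diff_locallyP; rewrite E.
Qed.

End DiffEstimate.

Lemma is_derive_within (R : realType) (D : set R) (c : R -> R) t l :
  is_derive t (1 : R) c l -> has_derive_within D c t l.
Proof.
move=> [dc <-] e e0.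
have := diff_le (iffLR (derivable1_diffP _ _) dc) e0.
apply: filterS => s H Ds; move: H; rewrite deriv1E// derive1E.
exact.
Qed.

Section DeriveWithinTheory.
Context {R : realType} {W : normedModType R} (D : set R).
Implicit Types (c : R -> W) (t : R) (l : W).

Lemma has_derive_within_lipschitz c t l : has_derive_within D c t l ->
  \forall s \near t, D s -> `|c s - c t| <= (1 + `|l|) * `|s - t|.
Proof.
move=> /(_ _ ltr01); apply: filterS => s + Ds => /(_ Ds).
rewrite mul1r -[X in _ -> `|X| <= _](subrK ((s - t) *: l)) => H.
by rewrite (le_trans (ler_normD _ _))// normrZ mulrDl mul1r lerD// mulrC.
Qed.

Lemma has_derive_within_near c t l (P : W -> Prop) :
  has_derive_within D c t l -> (\forall y \near c t, P y) ->
  \forall s \near t, D s -> P (c s).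
Proof.
move=> dc /nbhs_normP[e /= e0 He]; move: (has_derive_within_continuous dc e0).
by apply: filterS => s H Ds; apply: He; rewrite /= distrC; exact: H.
Qed.

Lemma has_derive_within_comp (W' : normedModType R) (f : W -> W') c t l :
  differentiable f (c t) -> has_derive_within D c t l ->
  has_derive_within D (f \o c) t ('d f (c t) l).
Proof.
move=> df dc e e0.
have [k k0 Hk] := linear_lipschitz (diff_continuous df).
have l0 : 0 < 1 + `|l| by rewrite ltr_pwDl.
have e1 : 0 < e / 2 / (1 + `|l|) by rewrite !divr_gt0.
have e2 : 0 < e / 2 / k by rewrite !divr_gt0.
have near3 := has_derive_within_near dc (diff_le df e1).
near=> s => Ds /=.
have H1 : `|c s - c t| <= (1 + `|l|) * `|s - t|.
  by move: Ds; near: s; exact: has_derive_within_lipschitz.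
have H2 : `|c s - c t - (s - t) *: l| <= e / 2 / k * `|s - t|.
  by move: Ds; near: s; exact: dc.
have H3 : `|f (c s) - f (c t) - 'd f (c t) (c s - c t)| <=
    e / 2 / (1 + `|l|) * `|c s - c t|.
  by move: Ds; near: s; exact: near3.
have -> : f (c s) - f (c t) - (s - t) *: 'd f (c t) l =
    (f (c s) - f (c t) - 'd f (c t) (c s - c t)) +
    'd f (c t) (c s - c t - (s - t) *: l).
  by rewrite (linearB _ (c s - c t)) addrA subrK ['d f (c t) (_ *: _)]linearZZ.
rewrite (le_trans (ler_normD _ _))// [e in leRHS]splitr mulrDl lerD//.
  rewrite (le_trans H3)// (le_trans (ler_wpM2l (ltW e1) H1))//.
  by rewrite mulrA divfK ?gt_eqF.
rewrite (le_trans (Hk _))// (le_trans (ler_wpM2l (ltW k0) H2))//.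
by rewrite mulrA (mulrC k) divfK ?gt_eqF.
Unshelve. all: by end_near. Qed.

End DeriveWithinTheory.

Section DeriveWithinMore.
Context {R : realType} {V W : normedModType R} (D : set R).

Lemma has_derive_within_near_eq (c1 c2 : R -> V) t l :
  (\forall s \near t, D s -> c1 s = c2 s) -> c1 t = c2 t ->
  has_derive_within D c1 t l -> has_derive_within D c2 t l.
Proof.
move=> c12 ct dc e e0; rewrite -ct.
by apply: filterS2 c12 (dc e e0) => s Hs H Ds; rewrite -Hs//; exact: H.
Qed.

Lemma has_derive_within_pair (c1 : R -> V) (c2 : R -> W) t l1 l2 :
  has_derive_within D c1 t l1 -> has_derive_within D c2 t l2 ->
  has_derive_within D (fun s => (c1 s, c2 s)) t (l1, l2).
Proof.
move=> d1 d2 e e0; apply: filterS2 (d1 e e0) (d2 e e0) => s H1 H2 Ds.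
by rewrite prod_normE /= ge_max H1// H2.
Qed.

Lemma has_derive_within_is_diff (f df : V -> W) (c : R -> V) t l :
  is_diff (c t) f df -> has_derive_within D c t l ->
  has_derive_within D (fun s => f (c s)) t (df l).
Proof. by move=> [dF <-]; exact: has_derive_within_comp. Qed.

End DeriveWithinMore.

(** A barrier argument: the curve cannot cross the bound [b], since where it
    touches the bound its speed is smaller than the slope of [b].  The region
    [A] is where the derivative is known; it is carried along in the same
    induction, so that staying in a chart and obeying a growth estimate can be
    proved together. *)
Lemma norm_comparison (R : realType) (W : normedModType R) (T : R) (A : R -> Prop)
    (c : R -> W) (b db : R -> R) :
  A 0 -> `|c 0| <= b 0 ->
  (forall t, 0 < t <= T -> (forall s, 0 <= s < t -> A s /\ `|c s| <= b s) ->
     A t) ->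
  (forall t, 0 <= t < T -> A t -> \forall s \near t, 0 <= s <= T -> A s) ->
  (forall t, 0 <= t <= T -> A t ->
     exists2 l, has_derive_within `[0, T] c t l & `|c t| = b t -> `|l| < db t) ->
  (forall t, 0 <= t <= T -> has_derive_within `[0, T] b t (db t)) ->
  forall t, 0 <= t <= T -> A t /\ `|c t| <= b t.
Proof.
move=> A0 c0 Aclosed Aopen cA bb.
have near_lt t : 0 <= t <= T -> A t -> forall e : R, 0 < e ->
    \forall s \near t, 0 <= s <= T ->
      `|c s - c t| < e /\ `|b s - b t| < e.
  move=> tT At e e0; have [l dc _] := cA t tT At.
  near=> s => sT; split.
    by move: sT; near: s; exact: (has_derive_within_continuous dc).
  by move: sT; near: s; exact: (has_derive_within_continuous (bb t tT)).
apply: real_induction => //.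
- move=> t /andP[t0 tT] H; have At : A t.
    by apply: Aclosed H; rewrite t0.
  split=> //; rewrite leNgt; apply/negP => bct.
  have tT' : 0 <= t <= T by rewrite (ltW t0).
  have e0 : 0 < (`|c t| - b t) / 2 by rewrite divr_gt0// subr_gt0.
  have [s st] := nbhs_before t0 (near_lt t tT' At _ e0).
  have [_ cs] := H s st; case/andP: st => s0 st.
  rewrite s0 (le_trans (ltW st))// => /(_ isT)[H1 H2].
  move: H2; rewrite ltr_norml => /andP[_ H2].
  have H3 : `|c t| - `|c s| <= `|c s - c t|.
    by rewrite distrC lerB_dist.
  lra.
- move=> t /andP[t0 tT] [At ct].
  have tT' : 0 <= t <= T by rewrite t0 ltW.
  have Anear := Aopen t (introT andP (conj t0 tT)) At.
  suff cnear : \forall s \near t, t < s -> s <= T -> `|c s| <= b s.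
    near=> s => ts sT; have s0 : 0 <= s <= T by rewrite (le_trans t0 (ltW ts)).
    split; first by move: s0; near: s; exact: Anear.
    by move: ts sT; near: s; exact: cnear.
  move: ct; rewrite le_eqVlt => /predU1P[cbt|cbt]; last first.
    have e0 : 0 < (b t - `|c t|) / 2 by rewrite divr_gt0// subr_gt0.
    near=> s => ts sT; have s0 : 0 <= s <= T by rewrite (le_trans t0 (ltW ts)).
    have [H1 H2] : `|c s - c t| < (b t - `|c t|) / 2 /\
        `|b s - b t| < (b t - `|c t|) / 2.
      by move: s0; near: s; exact: near_lt.
    have H3 := lerB_dist (c s) (c t).
    by move: H2; rewrite ltr_norml => /andP[H2 _]; lra.
  (* On the boundary the strict bound on derivatives leaves the gap
     [db t - |l|], to be shared by the two first-order errors. *)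
  have [l dc /(_ cbt) ldb] := cA t tT' At.
  have e0 : 0 < (db t - `|l|) / 2 by rewrite divr_gt0// subr_gt0.
  near=> s => ts sT; have s0 : 0 <= s <= T by rewrite (le_trans t0 (ltW ts)).
  have H1 : `|c s - c t - (s - t) *: l| <= (db t - `|l|) / 2 * `|s - t|.
    by move: s0; near: s; exact: dc.
  have H2 : `|b s - b t - (s - t) *: db t| <= (db t - `|l|) / 2 * `|s - t|.
    by move: s0; near: s; exact: bb.
  have st0 : 0 < s - t by rewrite subr_gt0.
  have H3 : `|c s| <= `|c t| + ((s - t) * `|l| + (db t - `|l|) / 2 * `|s - t|).
    rewrite -[X in `|X|](subrK (c t)) addrC (le_trans (ler_normD _ _))//.
    rewrite lerD2l -[X in `|X|](subrK ((s - t) *: l)) addrC.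
    by rewrite (le_trans (ler_normD _ _))// normrZ (gtr0_norm st0)
      lerD2l -{2}(gtr0_norm st0).
  move: H2; rewrite /GRing.scale/= ler_norml => /andP[H2 _].
  rewrite (gtr0_norm st0) in H2 H3.
  rewrite cbt in H3; nra.
Unshelve. all: by end_near. Qed.

Lemma mean_value_le (R : realType) (W : normedModType R) (T M : R)
    (c dc : R -> W) : 0 <= T ->
  (forall t, 0 <= t <= T -> has_derive_within `[0, T] c t (dc t)) ->
  (forall t, 0 <= t <= T -> `|dc t| <= M) ->
  `|c T - c 0| <= M * T.
Proof.
move=> T0 cd cM; apply/ler_addgt0Pr => e e0.
(* The comparison needs a strictly larger slope; [k] keeps the excess below
   [e] over a segment of length [T]. *)
pose k := e / (T + 1).
have k0 : 0 < k by rewrite divr_gt0// ltr_wpDl.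
have H t : 0 <= t <= T -> True /\ `|c t - c 0| <= (M + k) * t.
  apply: (@norm_comparison _ _ T (fun=> True) (fun s => c s - c 0)
            (fun s => (M + k) * s) (fun=> M + k)) => //.
  - by rewrite subrr normr0 mulr0.
  - by move=> s _ _; near=> z.
  - move=> s sT _; exists (dc s); first exact/has_derive_within_shift/cd.
    by move=> _; rewrite ltr_pwDr// cM.
  - move=> s sT; apply: is_derive_within; apply: is_derive_eq.
    by rewrite /GRing.scale/= mulr1.
have [|_ HT] := H T; first by rewrite lexx T0.
rewrite (le_trans HT)// mulrDl lerD2l /k mulrAC ler_pdivrMr ?ltr_wpDl//.
by rewrite ler_wpM2l ?(ltW e0)// lerDl.
Unshelve. all: by end_near. Qed.

(** * Strict differentiability *)

(** The estimate compares two moving points.  This is what makes derivatives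
    at nearby base points controllable without any second derivative. *)
Definition strictly_differentiable (R : realType) (V W : normedModType R)
    (f : V -> W) (x : V) :=
  differentiable f x /\ forall e : R, 0 < e -> \forall p \near (x, x),
    `|f p.1 - f p.2 - 'd f x (p.1 - p.2)| <= e * `|p.1 - p.2|.

Lemma C1_at_strict (R : realType) (V W : normedModType R) (f : V -> W) x :
  C1_at f x -> strictly_differentiable f x.
Proof.
move=> [df cdf]; split; first exact: (nbhs_singleton df).
move=> e e0; have : \forall y \near x, differentiable f y /\
    forall v, `|'d f y v - 'd f x v| <= e * `|v|.
  exact: filterI (cdf e e0).
move=> /nbhs_ballP[r /= r0 Hr].
exists (ball x r, ball x r); first by split; exact: nbhsx_ballx.
move=> [y z] [/= yr zr].
have seg (s : R) : 0 <= s <= 1 -> ball x r (z + s *: (y - z)).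
  move=> /andP[s0 s1]; rewrite -ball_normE /=.
  have -> : x - (z + s *: (y - z)) = (1 - s) *: (x - z) + s *: (x - y).
    have E : s *: (x - y) - s *: (x - z) = - (s *: (y - z)).
      by rewrite -scalerBr opprB addrC addrA subrK -scalerN opprB.
    by rewrite opprD addrA -E scalerBl scale1r addrA addrAC.
  rewrite (le_lt_trans (ler_normD _ _))// !normrZ (ger0_norm s0).
  rewrite ger0_norm ?subr_ge0//.
  have := zr; have := yr; rewrite -ball_normE /= => H1 H2.
  have [->|s1'] := eqVneq s 1; first by rewrite subrr mul0r add0r mul1r.
  have s1'' : 0 < 1 - s by rewrite subr_gt0 lt_neqAle s1' s1.
  have -> : r = (1 - s) * r + s * r by rewrite mulrBl mul1r subrK.
  by rewrite ltr_leD// ?ltr_pM2l// ler_wpM2l// ltW.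
(* The mean value inequality along the segment [z, y], after subtracting the
   constant slope 'd f x (y - z). *)
pose c s := f (z + s *: (y - z)) - s *: 'd f x (y - z).
pose dc s := 'd f (z + s *: (y - z)) (y - z) - 'd f x (y - z).
have := @mean_value_le R W 1 (e * `|y - z|) c dc ler01.
rewrite /c /dc !scale1r !scale0r addr0 subr0 [z + (_ - _)]addrC subrK mulr1.
rewrite addrAC; apply => s s01.
- apply: has_derive_withinB.
    apply: (has_derive_within_comp (f := f) (c := fun s => z + s *: (y - z))).
      by have [] := Hr _ (seg s s01).
    move=> k k0; near=> t => _.
    by rewrite opprD addrACA subrr add0r -scalerBl subrr normr0 mulr_ge0// ltW.
  move=> k k0; near=> t => _.
  by rewrite -scalerBl subrr normr0 mulr_ge0// ltW.
- by have [_ +] := Hr _ (seg s s01); apply.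
Unshelve. all: by end_near. Qed.

Section StrictTheory.
Context {R : realType}.
Implicit Types (U V W : normedModType R).

Lemma differentiable_near_eq V W (f g : V -> W) x :
  (\forall y \near x, f y = g y) -> differentiable f x ->
  differentiable g x /\ 'd g x = 'd f x :> (V -> W).
Proof.
move=> fg df; suff : is_diff x g ('d f x) by case.
apply: is_diff_le; first exact: diff_continuous.
move=> e e0; have fgx := nbhs_singleton fg.
have := diff_le df e0; apply: filterS2 fg => y <-.
by rewrite -fgx.
Qed.

Lemma strict_near_eq V W (f g : V -> W) x :
  (\forall y \near x, f y = g y) -> strictly_differentiable f x ->
  strictly_differentiable g x.
Proof.
move=> fg [df sf]; have [dg E] := differentiable_near_eq fg df.
split; first exact: dg.
move=> e e0; rewrite E.
have fg1 : \forall p \near (x, x), f p.1 = g p.1 by exact: cvg_fst fg.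
have fg2 : \forall p \near (x, x), f p.2 = g p.2 by exact: cvg_snd fg.
by move: (sf e e0); apply: filterS3 fg1 fg2 => p <- <-.
Qed.

Lemma strict_lipschitz V W (f : V -> W) x : strictly_differentiable f x ->
  exists2 k : R, 0 < k & \forall p \near (x, x),
    `|f p.1 - f p.2| <= k * `|p.1 - p.2|.
Proof.
move=> [df sf]; have [k k0 Hk] := linear_lipschitz (diff_continuous df).
exists (1 + k); first by rewrite addr_gt0.
apply: filterS (sf _ ltr01) => p H.
rewrite -[X in `|X|](subrK ('d f x (p.1 - p.2))) (le_trans (ler_normD _ _))//.
by rewrite mulrDl lerD.
Qed.

Lemma strict_comp U V W (f : U -> V) (g : V -> W) x :
  strictly_differentiable f x -> strictly_differentiable g (f x) ->
  strictly_differentiable (g \o f) x.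
Proof.
move=> sf sg; have [df Hf] := sf; have [dg Hg] := sg.
split; first exact: differentiable_comp.
have [kf kf0 Hkf] := strict_lipschitz sf.
have [k k0 Hk] := linear_lipschitz (diff_continuous dg).
have fc := differentiable_continuous df.
move=> e e0.
have e1 : 0 < e / 2 / kf by rewrite !divr_gt0.
have e2 : 0 < e / 2 / k by rewrite !divr_gt0.
near=> p; rewrite diff_comp//=.
have H1 : `|f p.1 - f p.2| <= kf * `|p.1 - p.2| by near: p.
have H2 : `|f p.1 - f p.2 - 'd f x (p.1 - p.2)| <= e / 2 / k * `|p.1 - p.2|.
  by near: p; exact: Hf.
have H3 : `|g (f p.1) - g (f p.2) - 'd g (f x) (f p.1 - f p.2)| <=
    e / 2 / kf * `|f p.1 - f p.2|.
  near: p; have [[A B] [/= Ax Bx] AB] := Hg _ e1.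
  exists (f @^-1` A, f @^-1` B); first by split; exact: fc.
  by move=> [y z] [/= Ay Bz]; exact: (AB (f y, f z)).
have -> : g (f p.1) - g (f p.2) - 'd g (f x) ('d f x (p.1 - p.2)) =
    (g (f p.1) - g (f p.2) - 'd g (f x) (f p.1 - f p.2)) +
    'd g (f x) (f p.1 - f p.2 - 'd f x (p.1 - p.2)).
  by rewrite (linearB _ (f p.1 - f p.2))/= addrA subrK.
rewrite (le_trans (ler_normD _ _))// [e in leRHS]splitr mulrDl lerD//.
  rewrite (le_trans H3)// (le_trans (ler_wpM2l (ltW e1) H1))//.
  by rewrite mulrA divfK ?gt_eqF.
rewrite (le_trans (Hk _))// (le_trans (ler_wpM2l (ltW k0) H2))//.
by rewrite mulrA (mulrC k) divfK ?gt_eqF.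
Unshelve. all: by end_near. Qed.

Lemma strict_pair U V W (f : U -> V) (g : U -> W) x :
  strictly_differentiable f x -> strictly_differentiable g x ->
  strictly_differentiable (fun y => (f y, g y)) x.
Proof.
move=> [df sf] [dg sg]; split; first exact: differentiable_pair.
move=> e e0; rewrite diff_pair//; near=> p.
rewrite prod_normE/= ge_max; apply/andP; split; near: p; [exact: sf|exact: sg].
Unshelve. all: by end_near. Qed.

Lemma strict_linear V W (f : {linear V -> W}) x : continuous f ->
  strictly_differentiable f x.
Proof.
move=> fc; split; first exact: linear_differentiable.
move=> e e0; near=> p; rewrite diff_lin// -!linearB subrr linear0.
by rewrite normr0 mulr_ge0// ltW.
Unshelve. all: by end_near. Qed.

Lemma strict_fst V W (p : V * W) : strictly_differentiable (@fst V W) p.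
Proof. by apply: (@strict_linear _ _ (@fst V W)) => y; exact: cvg_fst. Qed.

Lemma strict_snd V W (p : V * W) : strictly_differentiable (@snd V W) p.
Proof. by apply: (@strict_linear _ _ (@snd V W)) => y; exact: cvg_snd. Qed.

Lemma strict_cst V W (a : W) (x : V) : strictly_differentiable (cst a) x.
Proof.
split=> [|e e0]; first exact: differentiable_cst.
by near=> p; rewrite diff_cst/= !subrr normr0 mulr_ge0// ltW.
Unshelve. all: by end_near. Qed.

Lemma strict_sub V W (f g : V -> W) x :
  strictly_differentiable f x -> strictly_differentiable g x ->
  strictly_differentiable (fun y => f y - g y) x.
Proof.
move=> [df sf] [dg sg]; split; first exact: (@differentiableB _ _ _ f g).
move=> e e0; have e2 : 0 < e / 2 by rewrite divr_gt0.
apply: filterS2 (sf _ e2) (sg _ e2) => p Hf Hg.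
have -> : 'd (fun y => f y - g y) x (p.1 - p.2) =
    'd f x (p.1 - p.2) - 'd g x (p.1 - p.2).
  exact: (congr1 (fun h : V -> W => h (p.1 - p.2)) (diffB df dg)).
rewrite (subr_interchange (f p.1)) (subr_interchange (f p.1 - f p.2)).
rewrite (le_trans (ler_normB _ _))// [e in leRHS]splitr mulrDl.
exact: (lerD Hf Hg).
Qed.

End StrictTheory.

(** * Regularity on spaces with finitely many coordinates *)

Lemma linear_le_continuous (R : realType) (V W : normedModType R)
    (L : {linear V -> W}) (k : R) : 0 < k ->
  (forall v, `|L v| <= k * `|v|) -> continuous L.
Proof.
move=> k0 Lk x; apply/cvgrPdist_lt => e e0.
have ek : 0 < k^-1 * e by rewrite mulr_gt0 ?invr_gt0.
apply/nbhs_normP; exists (k^-1 * e) => //= y xy.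
by rewrite -linearB (le_lt_trans (Lk _))// -ltr_pdivlMl.
Qed.

Section FiniteCoordinates.
Context {R : realType}.

(** Finite dimension in the form that the estimates use, stable under products. *)
Definition finite_coordinates (V : normedModType R) :=
  exists (k : nat) (b : 'I_k -> V) (a : V -> 'I_k -> R) (K : R),
    0 <= K /\
    forall v, v = \sum_i a v i *: b i /\ forall i, `|a v i| <= K * `|v|.

Lemma finite_coordinates_rV n : finite_coordinates 'rV[R]_n.
Proof.
exists n, (fun i => delta_mx 0 i), (fun (v : 'rV[R]_n) i => v 0 i), 1; split=> // v.
split; first exact: row_sum_delta.
move=> i; rewrite mul1r /Num.norm/= mx_normrE.
by apply/bigmax_geP; right; exists (0, i).
Qed.

Lemma finite_coordinates_pair (V W : normedModType R) :
  finite_coordinates V -> finite_coordinates W ->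
  finite_coordinates (V * W)%type.
Proof.
move=> [k [b [a [K [K0 H]]]]] [k' [b' [a' [K' [K'0 H']]]]].
exists (k + k')%N,
  (fun i : 'I_(k + k') => match fintype.split i with
    inl j => (b j, 0) | inr j => (0, b' j) end),
  (fun (v : (V * W)%type) (i : 'I_(k + k')) => match fintype.split i with
    inl j => a v.1 j | inr j => a' v.2 j end),
  (K + K'); split; first exact: addr_ge0.
move=> [v w]; split.
  rewrite big_split_ord/=.
  under eq_bigr => i _ do rewrite (unsplitK (inl i)).
  under [X in _ + X]eq_bigr => i _ do rewrite (unsplitK (inr i)).
  have [Ev _] := H v; have [Ew _] := H' w.
  apply: injective_projections; rewrite !(linearD, linear_sum)/=.
    rewrite [X in _ = _ + X]big1 ?addr0 => [|i _]; last by rewrite scaler0.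
    exact: Ev.
  rewrite [X in _ = X + _]big1 ?add0r => [|i _]; last by rewrite scaler0.
  exact: Ew.
move=> i; case: fintype.split => j /=; rewrite prod_normE/=.
  have [_ /(_ j) Hj] := H v; rewrite (le_trans Hj)//.
  by rewrite ler_pM ?lerDl// le_max lexx.
have [_ /(_ j) Hj] := H' w; rewrite (le_trans Hj)//.
by rewrite ler_pM ?lerDr// le_max lexx orbT.
Qed.

Section Linear.
Context (V W : normedModType R) (finV : finite_coordinates V).

Lemma finite_linear_bounded (L : {linear V -> W}) :
  exists2 k : R, 0 < k & forall v, `|L v| <= k * `|v|.
Proof.
have [n [b [a [K [K0 H]]]]] := finV.
exists (1 + \sum_i K * `|L (b i)|).
  by rewrite ltr_pwDl// sumr_ge0// => i _; rewrite mulr_ge0.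
move=> v; have [Ev av] := H v.
rewrite [in leLHS]Ev linear_sum (le_trans (ler_norm_sum _ _ _))//.
rewrite mulrDl mul1r ler_wpDl// mulr_suml ler_sum// => i _.
by rewrite linearZZ normrZ mulrAC ler_wpM2r.
Qed.

(** Pointwise convergence on the finitely many vectors [b i] controls all
    vectors, as coordinates are bounded by the norm. *)
Lemma finite_linear_cvg (T : Type) (F : set_system T) (FF : Filter F)
    (L : T -> {linear V -> W}) (L0 : {linear V -> W}) :
  (forall v (e : R), 0 < e -> \forall t \near F, `|L t v - L0 v| <= e) ->
  forall e : R, 0 < e ->
    \forall t \near F, forall v, `|L t v - L0 v| <= e * `|v|.
Proof.
have [n [b [a [K [K0 H]]]]] := finV.
move=> LL e e0; pose e1 := e / (n%:R * K + 1).
have nK : 0 < n%:R * K + 1 by rewrite ltr_wpDl// mulr_ge0.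
have e10 : 0 < e1 by rewrite divr_gt0.
have : \forall t \near F, forall i, `|L t (b i) - L0 (b i)| <= e1.
  by apply: filter_forall => i; exact: LL.
apply: filterS => t Ht v; have [Ev av] := H v.
rewrite [X in L t X - L0 X]Ev (linear_sum (L t)) (linear_sum L0) -sumrB.
rewrite (le_trans (ler_norm_sum _ _ _))//.
apply: (@le_trans _ _ (\sum_(i < n) K * `|v| * e1)).
  apply: ler_sum => i _; rewrite (linearZZ (L t)) (linearZZ L0) -scalerBr normrZ.
  by apply: ler_pM => //; exact: Ht.
rewrite sumr_const card_ord -[leLHS]mulr_natl.
rewrite (_ : _ * _ = e1 * (n%:R * K) * `|v|); last by ring.
rewrite ler_wpM2r// /e1 mulrAC ler_pdivrMr// ler_wpM2l ?(ltW e0)//.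
by rewrite lerDl.
Qed.

End Linear.

End FiniteCoordinates.

Section FiniteC1.
Context {R : realType} {V W : normedModType R}.
Hypothesis finV : finite_coordinates V.

Lemma C1_at_finite (f : V -> W) x :
  (\forall y \near x, differentiable f y) ->
  (forall v, {for x, continuous (fun y => 'd f y v)}) -> C1_at f x.
Proof.
move=> df cdf; split=> // e e0.
apply: (finite_linear_cvg finV) => // v k k0.
have /cvgrPdist_le/(_ _ k0) := cdf v.
by apply: filterS => y; rewrite distrC.
Qed.

(** Continuity of the tangent map gives pointwise continuity of the
    differential, which finite dimension upgrades to operator norm. *)
Lemma Ck1_strict (O : set V) (f : V -> W) x : open_nbhs x O -> Ck 1%N O f ->
  strictly_differentiable f x.
Proof.
move=> [Oo Ox] [/= df cdf]; apply: C1_at_strict; apply: C1_at_finite.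
  by apply: filterS (open_nbhs_nbhs (conj Oo Ox)) => y /df.
move=> v; have /= H := cdf (x, v) (conj Ox I).
have pc : (y, v) @[y --> x] --> (x, v).
  by apply: cvg_pair; [exact: cvg_id|exact: cvg_cst].
exact: cvg_comp pc H.
Qed.

End FiniteC1.

(** Second-order regularity enters only through the tangent map. *)
Lemma smooth_near_tangent (R : realType) (V W : normedModType R) (f : V -> W) x :
  finite_coordinates V -> smooth_near f x ->
  [/\ \forall y \near x, differentiable f y,
      strictly_differentiable f x
    & forall v, strictly_differentiable (fun p : V * V => 'd f (p.1) (p.2)) (x, v)].
Proof.
move=> finV [S [So Sx] fS]; split.
- by have [df _] := fS 1%N; apply: filterS (open_nbhs_nbhs (conj So Sx)) => y /df.
- exact: Ck1_strict (conj So Sx) (fS 1%N).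
- move=> v; have [_ H] := fS 2%N.
  apply: (Ck1_strict (finite_coordinates_pair finV finV) _ H).
  split; last by split.
  rewrite openE => -[y w] [/= Sy _]; exists (S, setT) => //=.
  by split; [exact: (open_nbhs_nbhs (conj So Sy))|exact: filterT].
Qed.

(** * Symmetry of second derivatives *)

Section Schwarz.
Context {R : realType} {V W : normedModType R}.

(** The mean value inequality in the direction [k], applied to the increment of
    [f] in the direction [h]; the directional derivatives at both ends of the
    increment are expanded at [x]. *)
Lemma second_difference (f : V -> W) x h k :
  (\forall y \near x, differentiable f y) ->
  differentiable (fun y => 'd f y k) x ->
  forall e : R, 0 < e -> \forall s \near 0^'+,
    `|f (x + s *: h + s *: k) - f (x + s *: h) - (f (x + s *: k) - f x)
      - (s * s) *: 'd (fun y => 'd f y k) x h| <= e * (s * s).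
Proof.
move=> df dG e e0; set G := fun y => 'd f y k in dG *.
pose C := `|h| + `|k| + `|k| + 1.
have C0 : 0 < C by rewrite ltr_wpDl// !addr_ge0.
have e1 : 0 < e / C by rewrite divr_gt0.
have : \forall y \near x, differentiable f y /\
    `|G y - G x - 'd G x (y - x)| <= e / C * `|y - x|.
  exact: filterI (diff_le dG e1).
move=> /nbhs_normP[r /= r0 Hr].
have rC : 0 < r / C by rewrite divr_gt0.
near=> s.
have s0 : 0 < s by near: s; exact: nbhs_right_gt.
have sr : s * C < r.
  by rewrite -ltr_pdivlMr//; near: s; exact: nbhs_right_lt.
have inB (t a : R) : 0 <= t <= s -> 0 <= a <= 1 ->
    `|a *: (s *: h) + t *: k| <= s * (`|h| + `|k|).
  move=> /andP[t0 ts] /andP[a0 a1].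
  rewrite (le_trans (ler_normD _ _))// !normrZ (ger0_norm t0) (ger0_norm a0).
  rewrite (gtr0_norm s0) mulrDr lerD ?ler_wpM2r// ler_piMl//.
  by rewrite mulr_ge0// ltW.
have near_x v : `|v| <= s * (`|h| + `|k|) -> `|x - (x + v)| < r.
  move=> vs; rewrite opprD addrA subrr add0r normrN (le_lt_trans vs)//.
  rewrite (lt_trans _ sr)// ltr_pM2l// /C -addrA ltrDl.
  by rewrite ltr_wpDl.
(* One increment is frozen at [s *: h], the other is run from [0] to
   [s *: k]. *)
pose c t := f (x + (s *: h + t *: k)) - f (x + t *: k) - t *: (s *: 'd G x h).
pose dc t := 'd f (x + (s *: h + t *: k)) k - 'd f (x + t *: k) k - s *: 'd G x h.
have B1 t : 0 <= t <= s -> `|s *: h + t *: k| <= s * (`|h| + `|k|).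
  by move=> ts; have := inB t 1 ts; rewrite scale1r lexx ler01; exact.
have B0 t : 0 <= t <= s -> `|t *: k| <= s * (`|h| + `|k|).
  by move=> ts; have := inB t 0 ts; rewrite scale0r add0r lexx ler01; exact.
have : `|c s - c 0| <= e * s * s; last first.
  rewrite /c !scale0r !addr0 subr0 !addrA scalerA -mulrA [X in `|X| <= _]addrAC.
  by rewrite (subr_interchange (f (x + s *: h + s *: k))).
apply: (mean_value_le (dc := dc) (ltW s0)) => t ts.
- apply: has_derive_withinB; last first.
    move=> a a0; near=> b => _.
    by rewrite -scalerBl subrr normr0 mulr_ge0// ltW.
  apply: has_derive_withinB.
    apply: (has_derive_within_comp (f := f) (c := fun t => x + (s *: h + t *: k))).
      by have [] := Hr _ (near_x _ (B1 t ts)).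
    move=> a a0; near=> b => _.
    rewrite opprD addrACA subrr add0r opprD addrACA subrr add0r.
    by rewrite -!scalerBl subrr scale0r normr0 mulr_ge0// ltW.
  apply: (has_derive_within_comp (f := f) (c := fun t => x + t *: k)).
    by have [] := Hr _ (near_x _ (B0 t ts)).
  move=> a a0; near=> b => _.
  rewrite opprD addrACA subrr add0r.
  by rewrite -!scalerBl subrr scale0r normr0 mulr_ge0// ltW.
- have [_ H1] := Hr _ (near_x _ (B1 t ts)).
  have [_ H2] := Hr _ (near_x _ (B0 t ts)).
  rewrite [x + _]addrC addrK in H1.
  rewrite [x + t *: k]addrC addrK in H2.
  rewrite /dc -/(G _) -/(G (x + t *: k)).
  have -> : G (x + (s *: h + t *: k)) - G (x + t *: k) - s *: 'd G x h =
      (G (s *: h + t *: k + x) - G x - 'd G x (s *: h + t *: k)) -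
      (G (t *: k + x) - G x - 'd G x (t *: k)).
    rewrite (subr_interchange (G _ - G x)) (subr_interchange (G _)) subrr subr0.
    rewrite -(linearB ('d G x)) addrK ['d G x (_ *: _)]linearZZ.
    by rewrite (addrC _ x) [t *: k + x]addrC.
  rewrite (le_trans (ler_normB _ _))// (le_trans (lerD H1 H2))//.
  rewrite -mulrDr mulrAC ler_pdivrMr// -mulrA ler_pM2l//.
  have t0 : 0 <= t by case/andP: ts.
  have -> : s * C = s * (`|h| + `|k|) + s * (`|k| + 1) by rewrite /C; ring.
  rewrite lerD ?B1// normrZ (ger0_norm t0).
  case/andP: ts => _ ts; rewrite ler_pM// lerDl//.
Unshelve. all: by end_near. Qed.

(** The second difference is symmetric in [h] and [k]. *)
Lemma second_diff_sym (f : V -> W) x h k :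
  (\forall y \near x, differentiable f y) ->
  (forall v, differentiable (fun y => 'd f y v) x) ->
  'd (fun y => 'd f y k) x h = 'd (fun y => 'd f y h) x k.
Proof.
move=> df dG; apply/eqP; rewrite -subr_eq0 -normr_le0.
apply/ler_addgt0Pr => e e0; rewrite add0r.
have e2 : 0 < e / 2 by rewrite divr_gt0.
have N1 := second_difference h df (dG k) e2.
have N2 := second_difference k df (dG h) e2.
near (0 : R)^'+ => s.
have s0 : 0 < s * s by rewrite mulr_gt0//; near: s; exact: nbhs_right_gt.
have H1 : `|f (x + s *: h + s *: k) - f (x + s *: h) - (f (x + s *: k) - f x)
      - (s * s) *: 'd (fun y => 'd f y k) x h| <= e / 2 * (s * s).
  by near: s; exact: N1.
have : `|f (x + s *: k + s *: h) - f (x + s *: k) - (f (x + s *: h) - f x)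
      - (s * s) *: 'd (fun y => 'd f y h) x k| <= e / 2 * (s * s).
  by near: s; exact: N2.
rewrite (addrAC x) (subr_interchange (f _) (f (x + s *: k))) => H2.
rewrite -(ler_pM2l s0) -[X in X * _](gtr0_norm s0) -normrZ scalerBr.
rewrite [leRHS]mulrC [e in leRHS]splitr mulrDl.
apply: le_trans (lerD H2 H1); apply: le_trans (ler_normB _ _).
by set D := f _ - _ - _; rewrite (opprB D) [X in _ <= `|X|]addrC subrKA.
Unshelve. all: by end_near. Qed.

End Schwarz.

(** * Partial differentials and the differential of a local inversion *)

Section NearProjections.
Context {R : realType} {U V : normedModType R} (p : U * V).

Lemma near_fst (P : U -> Prop) :
  (\forall x \near p.1, P x) -> \forall q \near p, P q.1.
Proof. by move=> HP; case: p HP => x y /= HP; exact: cvg_fst HP. Qed.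

Lemma near_partiall (P : U * V -> Prop) :
  (\forall q \near p, P q) -> \forall x \near p.1, P (x, p.2).
Proof.
case: p => a b /= [[A B] [/= Aa Bb] AB]; apply: filterS Aa => x Ax.
by apply: AB; split=> //=; exact: nbhs_singleton.
Qed.

Lemma near_partialr (P : U * V -> Prop) :
  (\forall q \near p, P q) -> \forall y \near p.2, P (p.1, y).
Proof.
case: p => a b /= [[A B] [/= Aa Bb] AB]; apply: filterS Bb => y By.
by apply: AB; split=> //=; exact: nbhs_singleton.
Qed.

End NearProjections.

Section PairWithConstant.
Context {R : realType} {U V W : normedModType R}.

Lemma is_diff_pairl (a : W) (f df : U -> V) x : is_diff x f df ->
  is_diff x (fun y => (f y, a)) (fun v => (df v, 0)).
Proof. by move=> Hf; exact: (is_diff_pair Hf (is_diff_cst a x)). Qed.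

Lemma is_diff_pairr (a : W) (f df : U -> V) x : is_diff x f df ->
  is_diff x (fun y => (a, f y)) (fun v => (0, df v)).
Proof. by move=> Hf; exact: (is_diff_pair (is_diff_cst a x) Hf). Qed.

Lemma is_diff_near_eq (f g df : U -> V) x :
  (\forall y \near x, f y = g y) -> is_diff x f df -> is_diff x g df.
Proof.
move=> fg [dF E]; have [dg Eg] := differentiable_near_eq fg dF.
by apply: DiffDef; [exact: dg|rewrite Eg].
Qed.

Lemma is_diff_unique (f df df' : U -> V) x :
  is_diff x f df -> is_diff x f df' -> df =1 df'.
Proof. by move=> [_ <-] [_ <-]. Qed.

End PairWithConstant.

Section PartialDifferentials.
Context {R : realType} {U V W : normedModType R}.

Lemma is_diff_partialr (f : W * U -> V) a y : differentiable f (a, y) ->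
  is_diff y (fun z => f (a, z)) (fun v => 'd f (a, y) (0, v)).
Proof.
move=> df; have [dk Ek] := is_diff_pairr a (is_diff_id y).
apply: DiffDef; first exact: (differentiable_comp dk df).
by rewrite (diff_comp dk df) Ek.
Qed.

Lemma is_diff_partiall (f : U * W -> V) a y : differentiable f (y, a) ->
  is_diff y (fun z => f (z, a)) (fun v => 'd f (y, a) (v, 0)).
Proof.
move=> df; have [dk Ek] := is_diff_pairl a (is_diff_id y).
apply: DiffDef; first exact: (differentiable_comp dk df).
by rewrite (diff_comp dk df) Ek.
Qed.

End PartialDifferentials.

Section PairIdentity.
Context {R : realType} {V W : normedModType R}.

Lemma partialr_id (f : W * V -> V) a y : differentiable f (a, y) ->
  (\forall z \near y, f (a, z) = z) -> forall v, 'd f (a, y) (0, v) = v.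
Proof.
move=> df fid v; have := is_diff_near_eq fid (is_diff_partialr df).
by move=> /is_diff_unique/(_ (is_diff_id y))/(_ v).
Qed.

Lemma partiall_id (f : V * W -> V) a y : differentiable f (y, a) ->
  (\forall z \near y, f (z, a) = z) -> forall v, 'd f (y, a) (v, 0) = v.
Proof.
move=> df fid v; have := is_diff_near_eq fid (is_diff_partiall df).
by move=> /is_diff_unique/(_ (is_diff_id y))/(_ v).
Qed.

End PairIdentity.

Lemma is_diff_compose (R : realType) (U V W : normedModType R)
    (f df : U -> V) (g dg : V -> W) x :
  is_diff x f df -> is_diff (f x) g dg ->
  is_diff x (fun y => g (f y)) (fun v => dg (df v)).
Proof.
move=> [dF Ef] [dG Eg]; apply: DiffDef; first exact: (differentiable_comp dF dG).
by rewrite (diff_comp dF dG) Ef Eg.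
Qed.

Lemma is_diff_sub (R : realType) (U V : normedModType R)
    (f df g dg : U -> V) x :
  is_diff x f df -> is_diff x g dg ->
  is_diff x (fun y => f y - g y) (fun v => df v - dg v).
Proof. by move=> Hf Hg; exact: is_diffB Hf Hg. Qed.

Lemma is_diff_graph (R : realType) (U V W : normedModType R)
    (f df : U -> V) (g : U * V -> W) x :
  is_diff x f df -> differentiable g (x, f x) ->
  is_diff x (fun y => g (y, f y)) (fun v => 'd g (x, f x) (v, df v)).
Proof.
move=> Hf dg.
exact: (is_diff_compose (is_diff_pair (is_diff_id x) Hf) (differentiableP dg)).
Qed.

Section InversionDifferential.
Context {R : realType} {V : normedModType R}.

(** If [m] has a two-sided unit [e] and [j] inverts it near [e], then
    differentiating [m (z, j z) = e] shows that [j] reverses first-order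
    displacements. *)
Lemma inversion_diff (m : V * V -> V) (j : V -> V) (e : V) :
  differentiable m (e, e) -> differentiable j e -> j e = e ->
  (\forall z \near e, m (e, z) = z) -> (\forall z \near e, m (z, e) = z) ->
  (\forall z \near e, m (z, j z) = e) -> is_diff e j (fun v => - v).
Proof.
move=> dm dj je ml mr mj; apply: DiffDef; first exact: dj.
apply/funext => v.
have dm' : differentiable m (e, j e) by rewrite je.
have H := is_diff_graph (differentiableP dj) dm'.
have H0 : is_diff e (fun z => m (z, j z)) (fun=> 0).
  apply: is_diff_near_eq (is_diff_cst e e).
  by apply: filterS mj => z ->.
have := is_diff_unique H H0 v; rewrite je.
have -> : (v, 'd j e v) = (v, 0) + (0, 'd j e v) :> V * V.
  by apply: injective_projections; rewrite /= ?addr0 ?add0r.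
rewrite linearD (partiall_id dm mr) (partialr_id dm ml).
by move=> /eqP; rewrite addrC addr_eq0 => /eqP.
Qed.

(** First-order expansion of (inverse of p.1) * y * p.2 at the unit, in
    coordinates. *)
Lemma product_diff (m : V * V -> V) (j : V -> V) (e y : V) :
  differentiable m (e, y) -> differentiable m (y, e) ->
  is_diff e j (fun v => - v) -> j e = e -> m (y, e) = y ->
  is_diff (e, e) (fun p => m (j p.1, m (y, p.2)))
    (fun v => 'd m (e, y) (0, 'd m (y, e) (0, v.2)) - 'd m (e, y) (v.1, 0)).
Proof.
move=> d1 d2 dj je my.
have Hf := differentiableP (strict_fst (e, e)).1.
have Hs := differentiableP (strict_snd (e, e)).1.
have Hj : is_diff (e, e) (fun p : V * V => j p.1) (fun v => - v.1).
  have [dF Ef] : is_diff (e, e) (fun p : V * V => j p.1)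
      (fun v => - ('d fst (e, e) v : V)) := is_diff_compose Hf dj.
  apply: DiffDef; first exact: dF.
  rewrite Ef; apply/funext => v; congr (- _).
  by rewrite (@diff_lin _ _ _ fst)// => q; exact: cvg_fst.
have Hm : is_diff (e, e) (fun p : V * V => m (y, p.2)) (fun v => 'd m (y, e) (0, v.2)).
  have [dF Ef] : is_diff (e, e) (fun p : V * V => m (y, p.2))
      (fun v => 'd m (y, e) (0, 'd snd (e, e) v : V)) :=
    is_diff_compose Hs (is_diff_partialr d2).
  apply: DiffDef; first exact: dF.
  rewrite Ef; apply/funext => v; congr ('d m _ (0, _)).
  by rewrite (@diff_lin _ _ _ snd)// => q; exact: cvg_snd.
have d1' : differentiable m (j (e, e).1, m (y, (e, e).2)) by rewrite /= je my.
have [dF Ef] := is_diff_compose (is_diff_pair Hj Hm) (differentiableP d1').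
apply: DiffDef; first exact: dF.
rewrite Ef; apply/funext => v /=; rewrite je my.
have -> : (- v.1, 'd m (y, e) (0, v.2)) =
    (0, 'd m (y, e) (0, v.2)) - (v.1, 0) :> V * V.
  by apply: injective_projections; rewrite /= ?subr0 ?sub0r.
by rewrite linearB.
Qed.

End InversionDifferential.

(** * Uniform linearization along a segment and Gronwall confinement *)

Section SegmentCompactness.
Context {R : realType} (T : R).

Lemma segment_near (I : Type) (F : set_system I) (P : I -> R -> Prop) :
  Filter F ->
  (forall t, 0 <= t <= T -> \forall s \near t & i \near F, 0 <= s <= T -> P i s) ->
  \forall i \near F, forall t, 0 <= t <= T -> P i t.
Proof.
move=> FF HP.
have /compact_near_coveringP := @segment_compact R 0 T.
move=> /(_ _ F (fun i s => 0 <= s <= T -> P i s) FF) cov.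
have : \near F, `[0, T] `<=` (fun s => 0 <= s <= T -> P F s).
  by apply: cov => t /= tT; apply: HP; move: tT; rewrite in_itv.
by apply: filterS => i Hi t tT; apply: Hi => //=; rewrite in_itv.
Qed.

(** By homogeneity. *)
Lemma linear_near_le (V W : normedModType R) (L1 L2 : {linear V -> W}) (e : R) :
  (\forall q \near (0 : V), `|L1 q - L2 q| <= e * `|q|) ->
  forall q, `|L1 q - L2 q| <= e * `|q|.
Proof.
move=> /nbhs_normP[r /= r0 Hr] q.
have q0 : 0 < `|q| + 1 by rewrite ltr_wpDl.
have [a a0 aq] : exists2 a, 0 < a & a * `|q| < r.
  exists (r / (`|q| + 1)); first exact: divr_gt0.
  by rewrite mulrAC ltr_pdivrMr// ltr_pM2l// ltrDl.
have := Hr (a *: q); rewrite /= sub0r normrN (linearZZ L1) (linearZZ L2).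
by rewrite -scalerBr !normrZ (gtr0_norm a0) mulrCA ler_pM2l//; apply.
Qed.

Lemma linear_family_bounded (V W : normedModType R)
    (L : R -> {linear V -> W}) :
  (forall t, 0 <= t <= T -> continuous (L t)) ->
  (forall t, 0 <= t <= T -> forall e : R, 0 < e ->
     \forall s \near t, 0 <= s <= T -> forall v, `|L s v - L t v| <= e * `|v|) ->
  exists2 K : R, 0 < K & forall t, 0 <= t <= T -> forall v, `|L t v| <= K * `|v|.
Proof.
move=> Lc Lct.
suff HK : \forall K \near +oo, forall t, 0 <= t <= T -> forall v, `|L t v| <= K * `|v|.
  near (+oo : set_system R) => K; exists K; first by near: K; exact: nbhs_pinfty_gt.
  by near: K.
apply: segment_near => t tT.
have [k k0 Hk] := linear_lipschitz (Lc t tT).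
have Hs := Lct t tT 1 ltr01.
exists ([set s | 0 <= s <= T -> forall v, `|L s v - L t v| <= 1 * `|v|],
        [set K | 1 + k <= K]).
  by split=> //=; apply: nbhs_pinfty_ge; exact: num_real.
move=> [s K] [/= Hs' kK] sT v.
rewrite -[L s v](subrK (L t v)) (le_trans (ler_normD _ _))//.
by rewrite (le_trans (lerD (Hs' sT v) (Hk v)))// -mulrDl ler_wpM2r.
Unshelve. all: by end_near. Qed.

End SegmentCompactness.

Section UniformLinearization.
Context {R : realType} {E V : normedModType R} (T : R).
Context (H : R -> E * V -> E) (p0 : E * V) (L : R -> {linear (E * V)%type -> E}).
Hypothesis Lc : forall t, 0 <= t <= T -> continuous (L t).
Hypothesis HL : forall t, 0 <= t <= T -> forall e : R, 0 < e ->
  \forall s \near t & p \near p0,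
    0 <= s <= T -> `|H s p - L t (p - p0)| <= e * `|p - p0|.

(** Two linear maps that approximate the same [H s] near [p0] are close. *)
Lemma linearization_continuous t : 0 <= t <= T -> forall e : R, 0 < e ->
  \forall s \near t, 0 <= s <= T -> forall q, `|L s q - L t q| <= e * `|q|.
Proof.
move=> tT e e0; have e2 : 0 < e / 2 by rewrite divr_gt0.
have [[A B] [/= At Bp] AB] := HL tT e2.
apply: filterS At => s As sT; apply: linear_near_le.
have [[A' B'] [/= A's B'p] AB'] := HL sT e2.
rewrite (near_shift p0) sub0r.
apply: filterS2 Bp B'p => p Hp H'p /=.
have H1 := AB (s, p) (conj As Hp) sT.
have H2 := AB' (s, p) (conj (nbhs_singleton A's) H'p) sT.
rewrite /= in H1 H2.
rewrite [e in leRHS]splitr mulrDl; apply: le_trans (lerD H1 H2).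
apply: le_trans (ler_normB _ _).
by rewrite opprB [X in _ <= `|X|]addrC subrKA.
Qed.

Lemma linearization_bounded : exists2 K : R, 0 < K &
  forall t, 0 <= t <= T -> forall q, `|L t q| <= K * `|q|.
Proof. exact: linear_family_bounded Lc linearization_continuous. Qed.

Lemma linearization_uniform (e : R) : 0 < e ->
  \forall p \near p0, forall t, 0 <= t <= T ->
    `|H t p - L t (p - p0)| <= e * `|p - p0|.
Proof.
move=> e0; have e2 : 0 < e / 2 by rewrite divr_gt0.
apply: (@segment_near _ _ _ (nbhs p0)
  (fun p t => `|H t p - L t (p - p0)| <= e * `|p - p0|)) => t tT.
have [[A B] [/= At Bp] AB] := HL tT e2.
exists ([set s | A s /\ (0 <= s <= T ->
    forall q, `|L s q - L t q| <= e / 2 * `|q|)], B).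
  by split=> //; exact: filterI At (linearization_continuous tT e2).
move=> [s p] [/= [As Ls] Bp'] sT.
have H1 := AB (s, p) (conj As Bp') sT.
have H2 := Ls sT (p - p0).
rewrite /= in H1.
rewrite [e in leRHS]splitr mulrDl; apply: le_trans (lerD H1 H2).
apply: le_trans (ler_normB _ _).
by rewrite opprB [X in _ <= `|X|]addrA subrK.
Qed.

(** The barrier is |w - w0| exp(a t).  It stays below [rho] and below the radius
    on which the linearization is valid once [w] is close to w0, so leaving the
    region [A] and exceeding the barrier are excluded at the same time.  The case
    [w = w0] is left out because the barrier degenerates there. *)
Lemma gronwall_escape (A : V -> R -> Prop) (y : V -> R -> E) (rho : R) :
  0 < rho ->
  (\forall w \near p0.2, w != p0.2 ->
    [/\ A w 0, y w 0 = p0.1,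
        forall t, 0 < t <= T ->
          (forall s, 0 <= s < t -> A w s /\ `|y w s - p0.1| <= rho) -> A w t,
        forall t, 0 <= t < T -> A w t ->
          \forall s \near t, 0 <= s <= T -> A w s
      & forall t, 0 <= t <= T -> A w t ->
          has_derive_within `[0, T] (y w) t (H t (y w t, w))]) ->
  exists2 K : R, 0 < K & \forall w \near p0.2, w != p0.2 ->
    forall t, 0 <= t <= T -> A w t /\ `|y w t - p0.1| <= K * `|w - p0.2|.
Proof.
move=> rho0 Hw; have [k k0 Lk] := linearization_bounded.
have [r /= r0 Hr] : exists2 r : R, 0 < r & forall p, `|p0 - p| < r ->
    forall t, 0 <= t <= T -> `|H t p - L t (p - p0)| <= 1 * `|p - p0|.
  by have /nbhs_normP := linearization_uniform ltr01; apply.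
(* The relative velocity is at most [k + 1] times the distance to [p0], so a
   growth rate of [k + 2] makes the exponential barrier strict. *)
pose a := k + 2; have a0 : 0 < a by rewrite addr_gt0.
pose K := expR (a * Num.max T 0); exists K; first exact: expR_gt0.
have expK t : 0 <= t <= T -> expR (a * t) <= K.
  move=> /andP[t0 tT]; rewrite ler_expR ler_pM2l// le_max tT//.
near=> w => ww0.
have [Aw0 yw0 Aclosed Aopen yd] : [/\ A w 0, y w 0 = p0.1,
        forall t, 0 < t <= T ->
          (forall s, 0 <= s < t -> A w s /\ `|y w s - p0.1| <= rho) -> A w t,
        forall t, 0 <= t < T -> A w t ->
          \forall s \near t, 0 <= s <= T -> A w s
      & forall t, 0 <= t <= T -> A w t ->
          has_derive_within `[0, T] (y w) t (H t (y w t, w))].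
  by move: ww0; near: w.
pose d := `|w - p0.2|.
have d0 : 0 < d by rewrite normr_gt0 subr_eq0.
have Kd : K * d < Num.min rho r.
  rewrite /d distrC -ltr_pdivlMl ?expR_gt0//; near: w.
  apply/nbhs_normP; exists (K^-1 * Num.min rho r) => //=.
  by rewrite mulr_gt0 ?invr_gt0 ?expR_gt0// lt_min rho0.
move: Kd; rewrite lt_min => /andP[Kdrho Kdr].
suff bnd t : 0 <= t <= T -> A w t /\ `|y w t - p0.1| <= d * expR (a * t).
  move=> t tT; have [At yt] := bnd t tT; split=> //; rewrite (le_trans yt)//.
  by rewrite mulrC ler_wpM2r ?(ltW d0)// expK.
apply: (@norm_comparison _ _ T (A w) (fun s => y w s - p0.1)
   (fun s => d * expR (a * s)) (fun s => d * (a * expR (a * s)))) => //.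
- by rewrite yw0 subrr normr0 mulr0 expR0 mulr1 ltW.
- move=> s /andP[s0 sT] Hs; apply: Aclosed; first by rewrite s0.
  move=> b bs; have [Ab yb] := Hs b bs; split=> //.
  rewrite (le_trans yb)// ltW// (le_lt_trans _ Kdrho)// mulrC.
  case/andP: bs => b0 bs.
  by rewrite ler_wpM2r ?(ltW d0)// expK// b0 (le_trans (ltW bs)).
- move=> s sT As; exists (H s (y w s, w)).
    exact/has_derive_within_shift/yd.
  move=> ys.
  have ds : d <= d * expR (a * s).
    rewrite ler_peMr ?(ltW d0)// -expR0 ler_expR mulr_ge0 ?(ltW a0)//.
    by case/andP: sT.
  have pn : `|(y w s, w) - p0| = d * expR (a * s).
    rewrite prod_normE/= -/d ys; exact/max_idPl.
  have pr : `|p0 - (y w s, w)| < r.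
    rewrite distrC pn (le_lt_trans _ Kdr)// mulrC.
    by rewrite ler_wpM2r ?(ltW d0)// expK.
  have H1 := Hr _ pr s sT; have H2 := Lk s sT ((y w s, w) - p0).
  have : `|H s (y w s, w)| <= 1 * `|(y w s, w) - p0| + k * `|(y w s, w) - p0|.
    apply: le_trans (lerD H1 H2).
    by rewrite -[X in `|X| <= _](subrK (L s ((y w s, w) - p0))) ler_normD.
  rewrite pn => H3; rewrite (le_lt_trans H3)//.
  rewrite -mulrDl [ltRHS]mulrCA ltr_pM2r ?mulr_gt0 ?expR_gt0//.
  by rewrite /a addrC ltrD2l ltr1n.
- move=> s sT; apply: is_derive_within; apply: is_derive_eq.
  by rewrite /GRing.scale/=; ring.
Unshelve. all: by end_near. Qed.

End UniformLinearization.

(** The mixed term (m s - m t) (c s - c t) is of second order because pointwise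
    continuity of [m] is uniform on the finite-dimensional space. *)
Lemma has_derive_within_pairing (R : realType) (E : normedModType R)
    (D : set R) (m : R -> {linear E -> R^o}) (c : R -> E) t (dm : E -> R) l :
  finite_coordinates E ->
  (forall v, has_derive_within D (fun s => m s v : R^o) t (dm v)) ->
  has_derive_within D c t l ->
  has_derive_within D (fun s => m s (c s) : R^o) t (dm (c t) + m t l).
Proof.
move=> finE md cd e e0.
have [k k0 Hk] := finite_linear_bounded finE (m t).
have l0 : 0 < 1 + `|l| by rewrite ltr_pwDl.
have e3 : 0 < e / 3 by rewrite divr_gt0.
have e3k : 0 < e / 3 / k by rewrite divr_gt0.
have e3l : 0 < e / 3 / (1 + `|l|) by rewrite divr_gt0.
have mcvg : \forall s \near within D (nbhs t),
    forall v, `|m s v - m t v| <= e / 3 / (1 + `|l|) * `|v|.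
  apply: (finite_linear_cvg finE) => // v b b0; rewrite near_withinE.
  apply: filterS (has_derive_within_continuous (md v) b0) => s Hs Ds.
  by rewrite ltW// Hs.
rewrite near_withinE in mcvg.
have N1 := md (c t) _ e3; have N2 := cd _ e3k.
have N3 := has_derive_within_lipschitz cd.
near=> s => Ds.
have H1 : `|m s (c t) - m t (c t) - (s - t) *: (dm (c t) : R^o)| <= e / 3 * `|s - t|.
  by move: Ds; near: s; exact: N1.
have H2 : `|c s - c t - (s - t) *: l| <= e / 3 / k * `|s - t|.
  by move: Ds; near: s; exact: N2.
have H3 : `|c s - c t| <= (1 + `|l|) * `|s - t|.
  by move: Ds; near: s; exact: N3.
have H4 : forall v, `|m s v - m t v| <= e / 3 / (1 + `|l|) * `|v|.
  by move: Ds; near: s; exact: mcvg.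
have -> : m s (c s) - m t (c t) - (s - t) *: (dm (c t) + m t l : R^o) =
    (m s (c t) - m t (c t) - (s - t) *: (dm (c t) : R^o)) +
    (m s (c s - c t) - m t (c s - c t)) + m t (c s - c t - (s - t) *: l).
  rewrite (linearB (m s)) (linearB (m t) (c s - c t)) (linearB (m t) (c s)).
  by rewrite (linearZZ (m t)) /GRing.scale/=; ring.
have -> : e * `|s - t| = e / 3 * `|s - t| + e / 3 * `|s - t| + e / 3 * `|s - t|.
  by rewrite -!mulrDl -[in LHS](divfK (_ : 3%:R != 0) e)//; field.
rewrite (le_trans (ler_normD _ _))// lerD//.
  rewrite (le_trans (ler_normD _ _))// lerD//.
  rewrite (le_trans (H4 _))// (le_trans (ler_wpM2l (ltW e3l) H3))//.
  by rewrite mulrA divfK ?gt_eqF.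
rewrite (le_trans (Hk _))// (le_trans (ler_wpM2l (ltW k0) H2))//.
by rewrite mulrA (mulrC k) divfK ?gt_eqF.
Unshelve. all: by end_near. Qed.

(** * First variation against an adjoint costate *)

Section Antiderivative.
Context {R : realType} (T : R) (T0 : 0 < T).
Local Notation mu := lebesgue_measure.

Lemma antiderivative (f : R -> R) : {within `[0, T], continuous f} ->
  exists2 Phi : R -> R,
    forall t, 0 <= t <= T -> has_derive_within `[0, T] Phi t (f t) &
    Phi T - Phi 0 = (\int[mu]_(t in `[0, T]) f t)%R.
Proof.
move=> /subspace_continuousP fc.
(* [f] is extended by its end values, so that the fundamental theorem applies
   on the larger segment [-1, T + 1] and the end points become interior. *)
pose clamp (x : R) := Num.max 0 (Num.min x T).
have clampT x : 0 <= clamp x <= T.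
  rewrite /clamp le_max lexx /= ge_max ge_min lexx orbT andbT ltW//.
have clampE x : 0 <= x <= T -> clamp x = x.
  by move=> /andP[x0 xT]; rewrite /clamp min_l// max_r.
have clampc : continuous clamp.
  move=> x; apply: (@continuous_max _ _ (fun=> 0) (fun y => Num.min y T)).
    exact: cvg_cst.
  by apply: (@continuous_min _ _ id (fun=> T)); [exact: cvg_id|exact: cvg_cst].
pose g := f \o clamp.
have gc : continuous g.
  move=> x; have xT : `[0, T]%classic (clamp x) by rewrite /= in_itv /= clampT.
  apply: cvg_comp (fc _ xT) => A.
  move=> NA; have : \forall y \near x, `[0, T]%classic (clamp y) -> A (clamp y).
    exact: clampc x _ NA.
  by apply: filterS => y; apply; rewrite /= in_itv /= clampT.
have gi a b : mu.-integrable `[a, b] (EFin \o g).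
  apply: continuous_compact_integrable; first exact: segment_compact.
  exact: continuous_subspaceT.
exists (fun x => \int[mu]_(t in `[-1, x]) g t)%R.
  move=> t tT; have /andP[t0 tT'] := tT; apply: is_derive_within.
  have [||d E] := @continuous_FTC1_closed R g (-1) t (T + 1) _ (gi _ _) _ (gc t).
  - by rewrite ltr_pwDr.
  - by rewrite (lt_le_trans _ t0)// ltrN10.
  apply: DeriveDef; first exact: d.
  by rewrite -derive1E E /g /= clampE.
rewrite Rintegral_itvB; [|exact: gi| | ]; last 2 first.
  by rewrite bnd_simp ltW// ltrN10.
  by rewrite bnd_simp ltW.
rewrite Rintegral_itv_obnd_cbnd; last first.
  by apply: integrableS (gi 0 T) => //; exact: subset_itv_oc_cc.
by apply: eq_Rintegral => x; rewrite inE /= in_itv /= => xT; rewrite /g/= clampE.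
Qed.

End Antiderivative.

Section FirstVariation.
Context {R : realType} {E V : normedModType R} (T : R) (T0 : 0 < T).
Context (H : R -> E * V -> E) (e0 : E) (w0 : V)
  (L : R -> {linear (E * V)%type -> E}) (m : R -> {linear E -> R^o}).
Hypothesis finE : finite_coordinates E.
Hypothesis Lc : forall t, 0 <= t <= T -> continuous (L t).
Hypothesis HL : forall t, 0 <= t <= T -> forall e : R, 0 < e ->
  \forall s \near t & p \near (e0, w0),
    0 <= s <= T -> `|H s p - L t (p - (e0, w0))| <= e * `|p - (e0, w0)|.
Hypothesis adjoint : forall t, 0 <= t <= T -> forall v,
  has_derive_within `[0, T] (fun s => m s v : R^o) t (- m t (L t (v, 0))).

Local Notation mu := lebesgue_measure.

Lemma costate_continuous t : 0 <= t <= T -> forall e : R, 0 < e ->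
  \forall s \near t, 0 <= s <= T -> forall v, `|m s v - m t v| <= e * `|v|.
Proof.
move=> tT e ep.
have : \forall s \near within `[0, T] (nbhs t),
    forall v, `|m s v - m t v| <= e * `|v|.
  apply: (finite_linear_cvg finE) => // v b b0; rewrite near_withinE.
  apply: filterS (has_derive_within_continuous (adjoint tT v) b0) => s Hs Ds.
  by rewrite ltW// Hs.
by rewrite near_withinE.
Qed.

Lemma costate_bounded : exists2 M : R, 0 < M &
  forall t, 0 <= t <= T -> forall v, `|m t v| <= M * `|v|.
Proof.
apply: linear_family_bounded costate_continuous => t tT v.
have [k k0 Hk] := finite_linear_bounded finE (m t).
exact: linear_le_continuous k0 Hk v.
Qed.

Lemma sensitivity_integrand_continuous (q : E * V) :
  {within `[0, T], continuous (fun t => m t (L t q) : R)}.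
Proof.
apply/subspace_continuousP => t tT; apply/cvgrPdist_le => e ep.
have {}tT : 0 <= t <= T by [].
have [M M0 HM] := costate_bounded.
have M1 : 0 < e / 2 / (M * (1 + `|q|)).
  by rewrite !divr_gt0// mulr_gt0// ltr_pwDl.
have M2 : 0 < e / 2 / (1 + `|L t q|) by rewrite !divr_gt0// ltr_pwDl.
rewrite near_withinE.
apply: filterS2 (linearization_continuous HL tT M1) (costate_continuous tT M2).
move=> s H1 H2 sT; have {}sT : 0 <= s <= T by [].
rewrite distrC.
have -> : m s (L s q) - m t (L t q) =
    m s (L s q - L t q) + (m s (L t q) - m t (L t q)).
  by rewrite (linearB (m s)) addrA subrK.
rewrite (le_trans (ler_normD _ _))// [e]splitr lerD//.
  rewrite (le_trans (HM s sT _))// (le_trans (ler_wpM2l (ltW M0) (H1 sT q)))//.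
  rewrite [leLHS](_ : _ = e / 2 * (`|q| / (1 + `|q|))); last first.
    by field; rewrite !gt_eqF// ltr_pwDl.
  rewrite ler_piMr ?divr_ge0 ?(ltW ep)//.
  by rewrite ler_pdivrMr ?ltr_pwDl// mul1r lerDr.
rewrite (le_trans (H2 sT _))// mulrAC ler_pdivrMr ?ltr_pwDl//.
by rewrite ler_wpM2l ?divr_ge0 ?(ltW ep)// lerDr.
Qed.

Definition sensitivity (dw : V) : R^o :=
  (\int[mu]_(t in `[0%R, T]) m t (L t (0, dw)))%R.

Lemma sensitivity_integrable q :
  mu.-integrable `[0, T] (EFin \o (fun t => m t (L t q) : R)).
Proof.
apply: continuous_compact_integrable; first exact: segment_compact.
exact: sensitivity_integrand_continuous.
Qed.

Lemma sensitivity_linear : linear sensitivity.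
Proof.
move=> a x y; rewrite /sensitivity.
have -> : a *: (\int[mu]_(t in `[0%R, T]) m t (L t (0, x)))%R =
    (\int[mu]_(t in `[0%R, T]) (a * m t (L t (0, x))))%R :> R.
  by rewrite RintegralZl//; exact: sensitivity_integrable.
rewrite -RintegralD//; last 2 first.
- exact: integrableZl (sensitivity_integrable (0, x)).
- exact: sensitivity_integrable (0, y).
apply: eq_Rintegral => t _.
have -> : (0, a *: x + y) = a *: (0, x) + (0, y) :> E * V.
  by apply: injective_projections; rewrite /= ?scaler0 ?addr0.
by rewrite !linearP.
Qed.

Lemma sensitivity_bounded : exists2 k : R, 0 < k &
  forall dw, `|sensitivity dw| <= k * `|dw|.
Proof.
have [M M0 HM] := costate_bounded.
have [k k0 Hk] := linearization_bounded Lc HL.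
exists (M * k * T); first by rewrite !mulr_gt0.
move=> dw; have [Phi dPhi EPhi] :=
  antiderivative T0 (@sensitivity_integrand_continuous (0, dw)).
rewrite /sensitivity -EPhi (_ : M * k * T * _ = M * (k * `|dw|) * T); last by ring.
apply: (mean_value_le (ltW T0) dPhi) => t tT.
rewrite (le_trans (HM t tT _))// ler_wpM2l ?(ltW M0)//.
rewrite (le_trans (Hk t tT _))// ler_wpM2l ?(ltW k0)//.
by rewrite prod_normE/= normr0 ge_max normr_ge0 lexx.
Qed.

(** The adjoint equation cancels the part of the derivative of
    [m t (y w t - e0)] that is linear in the displacement. *)
Lemma first_variation (y : V -> R -> E) (K : R) : 0 < K ->
  (\forall w \near w0, y w 0 = e0 /\ forall t, 0 <= t <= T ->
     has_derive_within `[0, T] (y w) t (H t (y w t, w)) /\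
     `|y w t - e0| <= K * `|w - w0|) ->
  forall e : R, 0 < e -> \forall w \near w0,
    `|m T (y w T - e0) - sensitivity (w - w0)| <= e * `|w - w0|.
Proof.
move=> K0 Hy e ep.
have [M M0 HM] := costate_bounded.
pose e1 := e / (M * (K + 1) * T).
have e10 : 0 < e1 by rewrite divr_gt0// !mulr_gt0// addr_gt0.
have /nbhs_normP[r /= r0 Hr] := linearization_uniform HL e10.
near=> w.
have [yw0 yw] : y w 0 = e0 /\ forall t, 0 <= t <= T ->
     has_derive_within `[0, T] (y w) t (H t (y w t, w)) /\
     `|y w t - e0| <= K * `|w - w0| by near: w.
have wr : (K + 1) * `|w - w0| < r.
  rewrite distrC -ltr_pdivlMl ?addr_gt0//; near: w.
  apply/nbhs_normP; exists ((K + 1)^-1 * r) => //=.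
  by rewrite mulr_gt0 ?invr_gt0 ?addr_gt0.
have [Phi dPhi EPhi] :=
  antiderivative T0 (@sensitivity_integrand_continuous (0, w - w0)).
pose q t := (m t (y w t - e0) : R^o) - Phi t.
have -> : m T (y w T - e0) - sensitivity (w - w0) = q T - q 0.
  by rewrite /q yw0 subrr linear0 sub0r opprK /sensitivity -EPhi opprB addrA addrAC.
(* By the adjoint equation the terms in [y w t - e0] cancel, and only the
   linearization error of [H] is left. *)
pose dq t := m t (H t (y w t, w) - L t (y w t - e0, w - w0)).
have -> : e * `|w - w0| = M * (e1 * ((K + 1) * `|w - w0|)) * T.
  by rewrite /e1; field; rewrite !gt_eqF// addr_gt0.
apply: (mean_value_le (dc := dq) (ltW T0)) => t tT; have [yd yK] := yw t tT.
  have -> : dq t = - m t (L t (y w t - e0, 0)) + m t (H t (y w t, w)) -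
     m t (L t (0, w - w0)).
    rewrite /dq (_ : (y w t - e0, w - w0) = (y w t - e0, 0) + (0, w - w0)); last first.
      by apply: injective_projections; rewrite /= ?addr0 ?add0r.
    by rewrite linearB/= linearD/= linearD/= opprD addrA [X in X - _]addrC.
  apply: has_derive_withinB (dPhi t tT).
  apply: (has_derive_within_pairing (c := fun s => y w s - e0)
    (dm := fun v => - m t (L t (v, 0)))) => //.
    by move=> v; exact: adjoint.
  exact: has_derive_within_shift.
have pn : `|(y w t, w) - (e0, w0)| <= (K + 1) * `|w - w0|.
  rewrite prod_normE/= ge_max; apply/andP; split.
    by rewrite (le_trans yK)// ler_wpM2r// lerDl.
  by rewrite ler_peMl// lerDr ltW.
rewrite /dq (le_trans (HM t tT _))// ler_wpM2l ?(ltW M0)//.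
have := Hr (y w t, w); rewrite /= distrC => /(_ (le_lt_trans pn wr) t tT).
by move=> /le_trans; apply; rewrite ler_wpM2l ?(ltW e10).
Unshelve. all: by end_near. Qed.

(** A terminal cost whose differential is the terminal costate sees exactly the
    pairing computed by [first_variation]. *)
Lemma adjoint_sensitivity (y : V -> R -> E) (K : R) (C : E -> R^o) : 0 < K ->
  (\forall w \near w0, y w 0 = e0 /\ forall t, 0 <= t <= T ->
     has_derive_within `[0, T] (y w) t (H t (y w t, w)) /\
     `|y w t - e0| <= K * `|w - w0|) ->
  differentiable C e0 -> 'd C e0 = m T :> (E -> R) ->
  is_diff w0 (fun w => C (y w T)) sensitivity.
Proof.
move=> K0 Hy dC CT.
pose sL := GRing.isLinear.Build _ _ _ _ _ sensitivity_linear.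
pose S : {linear V -> R^o} := HB.pack sensitivity sL.
have [k k0 Hk] := sensitivity_bounded.
have Ty : 0 <= T <= T by rewrite ltW/=.
have yw0T : y w0 T = e0.
  have [_ /(_ T Ty)[_]] := nbhs_singleton Hy.
  by rewrite subrr normr0 mulr0 normr_le0 subr_eq0 => /eqP.
apply: (is_diff_le (L := S)); first exact: (@linear_le_continuous _ _ _ S k).
move=> e ep; have e2 : 0 < e / 2 by rewrite divr_gt0.
have e2K : 0 < e / 2 / K by rewrite divr_gt0.
have /nbhs_normP[r /= r0 Hr] := diff_le dC e2K.
have N := first_variation K0 Hy e2.
near=> w.
have H1 : `|m T (y w T - e0) - sensitivity (w - w0)| <= e / 2 * `|w - w0|.
  by near: w.
have [_ /(_ T Ty)[_ yK]] : y w 0 = e0 /\ forall t, 0 <= t <= T ->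
     has_derive_within `[0, T] (y w) t (H t (y w t, w)) /\
     `|y w t - e0| <= K * `|w - w0| by near: w.
have wr : K * `|w - w0| < r.
  rewrite distrC -ltr_pdivlMl//; near: w.
  apply/nbhs_normP; exists (K^-1 * r) => //=.
  by rewrite mulr_gt0 ?invr_gt0.
have := Hr (y w T); rewrite /= distrC => /(_ (le_lt_trans yK wr)).
rewrite CT => H2; rewrite yw0T.
have -> : C (y w T) - C e0 - S (w - w0) = (C (y w T) - C e0 - m T (y w T - e0))
    + (m T (y w T - e0) - sensitivity (w - w0)) by rewrite addrA subrK.
rewrite (le_trans (ler_normD _ _))// [e]splitr mulrDl lerD//.
rewrite (le_trans H2)// (le_trans (ler_wpM2l (ltW e2K) yK))//.
by rewrite mulrA divfK ?gt_eqF.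
Unshelve. all: by end_near. Qed.

End FirstVariation.

(** * Charts and left trivialization *)

Section Charts.
Context {R : realType} {E : normedModType R} {M : manifoldType E}.
Implicit Types x y : M.

Lemma chart_near x y : chart_dom x y -> \forall z \near chart x y,
  chart_dom x (chart_inv x z) /\ chart x (chart_inv x z) = z.
Proof.
move=> xy; have Oc : open_nbhs (chart x y) (chart x @` chart_dom x).
  by split; [exact: chart_codom_open|exists y].
by apply: filterS (open_nbhs_nbhs Oc) => _ [y' xy' <-]; rewrite chartK.
Qed.

Lemma chart_dom_nbhs x y : chart_dom x y -> nbhs y (chart_dom x).
Proof. by move=> xy; apply: open_nbhs_nbhs; split=> //; exact: chart_dom_open. Qed.

Lemma chart_inv_center x : chart_inv x (chart x x) = x.
Proof. by rewrite chartK//; exact: chart_dom_center. Qed.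

Lemma chart_inv_cvg x y : chart_dom x y ->
  chart_inv x z @[z --> chart x y] --> y.
Proof.
move=> xy; rewrite -[in X in _ --> X](chartK _ _ xy).
by apply: chart_inv_continuous; exists y.
Qed.

Lemma chart_inv_near x y (P : M -> Prop) : chart_dom x y ->
  (\forall a \near y, P a) -> \forall z \near chart x y, P (chart_inv x z).
Proof. by move=> xy; exact: (@chart_inv_cvg x y xy P). Qed.

Lemma chart_map_near x y (P : E -> Prop) : chart_dom x y ->
  (\forall z \near chart x y, P z) -> \forall a \near y, P (chart x a).
Proof. by move=> xy; exact: (@chart_continuous R E M x y xy P). Qed.

Lemma chart_transition_diff x y z : chart_dom x z -> chart_dom y z ->
  differentiable (chart y \o chart_inv x) (chart x z).
Proof. by move=> xz yz; have [d _] := chart_transition x y 1%N; apply: d; exists z. Qed.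

End Charts.

Section LieCharts.
Context {R : realType} {n : nat} {G : lieGroupType R n}.
Local Notation E := 'rV[R]_n.
Implicit Types a x : G.

Definition mul_rep a (p : E * E) : E :=
  chart a (chart_inv a p.1 * chart_inv (1%g : G) p.2)%g.

(** The left factor is the coordinate of an inverse: with p.1 that of x^-1, this
    reads the left translation y |-> x^-1 * y near [a]. *)
Definition ldiv_rep a (p : E * E) : E :=
  chart (1%g : G) (chart_inv a^-1%g p.1 * chart_inv a p.2)%g.

Definition inv_rep a (z : E) : E := chart a^-1%g (chart_inv a z)^-1%g.

Lemma mul_rep_smooth a : smooth_near (mul_rep a) (chart a a, chart (1%g : G) 1%g).
Proof. by have := lie_mul_smooth a 1%g; rewrite mulg1. Qed.

Lemma ldiv_rep_smooth a :
  smooth_near (ldiv_rep a) (chart a^-1%g a^-1%g, chart a a).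
Proof. by have := lie_mul_smooth a^-1%g a; rewrite mulVg. Qed.

Lemma inv_rep_smooth a : smooth_near (inv_rep a) (chart a a).
Proof. exact: lie_inv_smooth. Qed.

Lemma finite_coordinates_rV2 : finite_coordinates (E * E)%type.
Proof.
exact: finite_coordinates_pair (finite_coordinates_rV _) (finite_coordinates_rV _).
Qed.

Lemma mulg_cvg a x : (y.1 * y.2)%g @[y --> (a, x)] --> (a * x)%g.
Proof. exact: (@lie_mul_continuous R n G (a, x)). Qed.

Lemma mulg_cvgl a x : (a * y)%g @[y --> x] --> (a * x)%g.
Proof.
have pc : (a, y) @[y --> x] --> (a, x).
  by apply: cvg_pair; [exact: cvg_cst|exact: cvg_id].
exact: (cvg_comp _ (fun p : G * G => (p.1 * p.2)%g) pc (@mulg_cvg a x)).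
Qed.

(** Differentiating y |-> x^-1 * y at [x] through the charts at [x0] and x0^-1,
    where the group law is smooth in both arguments: in this form the left
    trivialization depends smoothly on [x]. *)
Lemma left_triv_near (x0 : G) : \forall x \near x0,
  differentiable (chart (1%g : G) \o (fun y : G => (x^-1 * y)%g) \o chart_inv x)
    (chart x x) /\
  forall v : tangent x, left_triv v =
    'd (ldiv_rep x0) (chart x0^-1%g x^-1%g, chart x0 x)
      (0, 'd (chart x0 \o chart_inv x) (chart x x) v).
Proof.
have [dM _ _] := smooth_near_tangent finite_coordinates_rV2 (ldiv_rep_smooth x0).
have domV : \forall x \near x0, chart_dom x0^-1%g x^-1%g.
  apply: (@lie_inv_continuous R n G x0).
  exact: chart_dom_nbhs (chart_dom_center _).
have cc : (chart x0^-1%g x^-1%g, chart x0 x) @[x --> x0] -->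
    (chart x0^-1%g x0^-1%g, chart x0 x0).
  have h1 : chart x0^-1%g x^-1%g @[x --> x0] --> chart x0^-1%g x0^-1%g.
    apply: (cvg_comp _ (chart x0^-1%g) (@lie_inv_continuous R n G x0)).
    exact: chart_continuous (chart_dom_center _).
  have h2 : chart x0 x @[x --> x0] --> chart x0 x0.
    exact: chart_continuous (chart_dom_center _).
  exact: (cvg_pair h1 h2).
near=> x.
have xV : chart_dom x0^-1%g x^-1%g by near: x.
have xD : chart_dom x0 x by near: x; exact: chart_dom_nbhs (chart_dom_center _).
have dMx : differentiable (ldiv_rep x0) (chart x0^-1%g x^-1%g, chart x0 x).
  by near: x; exact: cc dM.
pose tau := chart x0 \o chart_inv x.
have dtau : differentiable tau (chart x x).
  exact: chart_transition_diff (chart_dom_center _) xD.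
have taux : tau (chart x x) = chart x0 x by rewrite /tau /= chart_inv_center.
pose k z := (chart x0^-1%g x^-1%g, tau z).
have [dk Ek] := is_diff_pairr (chart x0^-1%g x^-1%g) (differentiableP dtau).
have eqk : \forall z \near chart x x, (ldiv_rep x0 \o k) z =
    (chart (1%g : G) \o (fun y : G => (x^-1 * y)%g) \o chart_inv x) z.
  have : \forall z \near chart x x, chart_dom x0 (chart_inv x z).
    exact: (@chart_inv_cvg _ _ _ _ _ (chart_dom_center x) _ (chart_dom_nbhs xD)).
  by apply: filterS => z zD; rewrite /k /ldiv_rep /tau /= !chartK.
have dMk : differentiable (ldiv_rep x0) (k (chart x x)) by rewrite /k taux.
have [dL EL] := differentiable_near_eq eqk (differentiable_comp dk dMk).
split; first exact: dL.
move=> v; rewrite /left_triv /tangent_map /mdiff mulVg.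
rewrite [LHS](congr1 (fun h : E -> E => h v) EL).
rewrite [LHS](congr1 (fun h : E -> E => h v) (diff_comp dk dMk)) /=.
by rewrite [in LHS](congr1 (fun h : E -> E * E => h v) Ek) /k taux.
Unshelve. all: by end_near. Qed.

End LieCharts.

(** * Velocity of the relative position in the chart at the identity *)

Section RelativeMotion.
Context {R : realType} {n : nat} {G : lieGroupType R n}.
Context {V : normedModType R} {U : manifoldType V}.
Context (F : forall g : G, U -> tangent g).
Hypothesis C1F : C1_vf F.
Local Notation E := 'rV[R]_n.
Local Notation e0 := (chart (1%g : G) 1%g).
Implicit Types (x : G) (u : U).

Definition triv_rep x0 u (p : E * V) : E :=
  triv_vf F (chart_inv x0 p.1) (chart_inv u p.2).

Definition vf_chart x0 u (p : E * V) : E :=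
  vf_rep (fun x => F x (chart_inv u p.2)) x0 p.1.

Definition triv_arg x0 u (p : E * V) : (E * E) * (E * E) :=
  ((inv_rep x0 p.1, p.1), (0 : E, vf_chart x0 u p)).

Lemma vf_chart_strict x0 u :
  strictly_differentiable (vf_chart x0 u) (chart x0 x0, chart u u).
Proof. apply: C1_at_strict; exact: C1F. Qed.

Lemma triv_arg_strict x0 u :
  strictly_differentiable (triv_arg x0 u) (chart x0 x0, chart u u).
Proof.
have [_ sI _] := smooth_near_tangent (finite_coordinates_rV n) (inv_rep_smooth x0).
have sF := vf_chart_strict x0 u.
apply: strict_pair; apply: strict_pair.
- exact: (strict_comp (strict_fst (chart x0 x0, chart u u)) sI).
- exact: strict_fst.
- exact: strict_cst.
- exact: sF.
Qed.

Lemma triv_argE x0 u : triv_arg x0 u (chart x0 x0, chart u u) =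
  ((chart x0^-1%g x0^-1%g, chart x0 x0), (0, vf_chart x0 u (chart x0 x0, chart u u))).
Proof. by rewrite /triv_arg /inv_rep /= chart_inv_center. Qed.

Lemma vf_chartE x0 u z w : vf_chart x0 u (z, w) =
  'd (chart x0 \o chart_inv (chart_inv x0 z)) (chart (chart_inv x0 z) (chart_inv x0 z))
     (F (chart_inv x0 z) (chart_inv u w)).
Proof. by []. Qed.

(** The named predicate keeps the differentials folded when it is transported
    along a chart. *)
Definition left_triv_formula x0 x := forall v : tangent x, left_triv v =
    'd (ldiv_rep x0) (chart x0^-1%g x^-1%g, chart x0 x)
      (0, 'd (chart x0 \o chart_inv x) (chart x x) v).

Lemma left_triv_formula_near x0 : \forall x \near x0, left_triv_formula x0 x.
Proof. by apply: filterS (left_triv_near x0) => x []. Qed.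

Lemma triv_rep_of_formula x0 u z w : chart x0 (chart_inv x0 z) = z ->
  left_triv_formula x0 (chart_inv x0 z) ->
  'd (ldiv_rep x0) (inv_rep x0 z, z) (0, vf_chart x0 u (z, w)) = triv_rep x0 u (z, w).
Proof.
move=> Nz HL; rewrite vf_chartE.
transitivity (left_triv (F (chart_inv x0 z) (chart_inv u w))); last by [].
by rewrite HL Nz.
Qed.

Lemma triv_rep_near_center x0 u : \forall z \near chart x0 x0, forall w,
  'd (ldiv_rep x0) (inv_rep x0 z, z) (0, vf_chart x0 u (z, w)) = triv_rep x0 u (z, w).
Proof.
have N1 : \forall z \near chart x0 x0, chart x0 (chart_inv x0 z) = z.
  by apply: filterS (chart_near (chart_dom_center x0)) => z [].
have N2 := chart_inv_near (chart_dom_center x0) (left_triv_formula_near x0).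
apply: filterS2 N1 N2 => z Nz HL w.
exact: triv_rep_of_formula.
Qed.

Lemma triv_rep_near x0 u : \forall p \near (chart x0 x0, chart u u),
    'd (ldiv_rep x0) ((triv_arg x0 u p).1) ((triv_arg x0 u p).2) = triv_rep x0 u p.
Proof.
have : \forall p \near (chart x0 x0, chart u u), forall w,
  'd (ldiv_rep x0) (inv_rep x0 p.1, p.1) (0, vf_chart x0 u (p.1, w)) = triv_rep x0 u (p.1, w).
  exact: (near_fst (p := (chart x0 x0, chart u u)) (triv_rep_near_center x0 u)).
by apply: filterS => -[z w] /(_ w).
Qed.

(** The trivialized field is the tangent map of the smooth division map, evaluated
    on the chart representation of [F], which is C^1. *)
Lemma triv_rep_strict x0 u :
  strictly_differentiable (triv_rep x0 u) (chart x0 x0, chart u u).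
Proof.
have [_ _ sM] := smooth_near_tangent finite_coordinates_rV2 (ldiv_rep_smooth x0).
apply: strict_near_eq (triv_rep_near x0 u) _.
apply: (strict_comp (triv_arg_strict x0 u)
  (g := fun q : (E * E) * (E * E) => 'd (ldiv_rep x0) (q.1) (q.2))).
by rewrite triv_argE; exact: sM.
Qed.

(** The left-invariant vector field with value [q.2] at the identity, evaluated
    at [q.1] in the chart at the identity. *)
Definition left_rep (q : E * E) : E :=
  'd (mul_rep (1%g : G)) (q.1, e0) (0, q.2).

(** The right-invariant counterpart of [left_rep]. *)
Definition right_rep (q : E * E) : E :=
  'd (mul_rep (1%g : G)) (e0, q.1) (q.2, 0).

Lemma mul_rep1_tangent v :
  strictly_differentiable
    (fun p : (E * E) * (E * E) => 'd (mul_rep (1%g : G)) (p.1) (p.2))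
    ((e0, e0), v).
Proof.
by have [_ _] := smooth_near_tangent finite_coordinates_rV2 (mul_rep_smooth (1%g : G)).
Qed.

Lemma mul_rep1_diff_near :
  \forall p \near (e0, e0), differentiable (mul_rep (1%g : G)) p.
Proof.
by have [] := smooth_near_tangent finite_coordinates_rV2 (mul_rep_smooth (1%g : G)).
Qed.

Lemma left_rep_strict xi : strictly_differentiable left_rep (e0, xi).
Proof.
have sk : strictly_differentiable
    (fun q : E * E => ((q.1, e0), ((0 : E), q.2))) (e0, xi).
  apply: strict_pair; apply: strict_pair.
  - exact: strict_fst.
  - exact: strict_cst.
  - exact: strict_cst.
  - exact: strict_snd.
exact: (strict_comp sk (mul_rep1_tangent _)).
Qed.

Lemma right_rep_strict xi : strictly_differentiable right_rep (e0, xi).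
Proof.
have sk : strictly_differentiable
    (fun q : E * E => ((e0, q.1), (q.2, (0 : E)))) (e0, xi).
  apply: strict_pair; apply: strict_pair.
  - exact: strict_cst.
  - exact: strict_fst.
  - exact: strict_snd.
  - exact: strict_cst.
exact: (strict_comp sk (mul_rep1_tangent _)).
Qed.

Lemma mul_rep1_el (h : G) : chart_dom 1%g h ->
  \forall z \near chart 1%g h, mul_rep (1%g : G) (e0, z) = z.
Proof.
move=> hD; apply: filterS (chart_near hD) => z [_ Hz].
by rewrite /mul_rep /= chart_inv_center mul1g.
Qed.

Lemma mul_rep1_er (h : G) : chart_dom 1%g h ->
  \forall z \near chart 1%g h, mul_rep (1%g : G) (z, e0) = z.
Proof.
move=> hD; apply: filterS (chart_near hD) => z [_ Hz].
by rewrite /mul_rep /= chart_inv_center mulg1.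
Qed.

Lemma diff_mul_rep1l (h : G) v : chart_dom 1%g h ->
  differentiable (mul_rep (1%g : G)) (e0, chart 1%g h) ->
  'd (mul_rep (1%g : G)) (e0, chart 1%g h) (0, v) = v.
Proof.
by move=> hD dm; apply: (partialr_id dm); exact: mul_rep1_el.
Qed.

Lemma diff_mul_rep1r (h : G) v : chart_dom 1%g h ->
  differentiable (mul_rep (1%g : G)) (chart 1%g h, e0) ->
  'd (mul_rep (1%g : G)) (chart 1%g h, e0) (v, 0) = v.
Proof.
by move=> hD dm; apply: (partiall_id dm); exact: mul_rep1_er.
Qed.

Lemma left_rep1 xi : left_rep (e0, xi) = xi.
Proof.
by apply: diff_mul_rep1l (chart_dom_center _) (nbhs_singleton mul_rep1_diff_near).
Qed.

Lemma right_rep1 xi : right_rep (e0, xi) = xi.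
Proof.
by apply: diff_mul_rep1r (chart_dom_center _) (nbhs_singleton mul_rep1_diff_near).
Qed.

(** If c' = F(c, u) and d' = F(d, v), then h = c^-1 * d moves with the
    left-invariant velocity of [d] minus the right-invariant velocity of [c]; here
    [x] stands for [c], [p.1] for the coordinate of h and [p.2] for the coordinate
    of [v]. *)
Definition relative_velocity u x (p : E * V) : E :=
  left_rep (p.1, triv_vf F (x * chart_inv (1%g : G) p.1)%g (chart_inv u p.2))
  - right_rep (p.1, triv_vf F x u).

(** [relative_velocity] with [x] also read in a chart, so that joint regularity
    in the base point can be expressed. *)
Definition relative_rep u x0 (r : E * (E * V)) : E :=
  left_rep (r.2.1, triv_rep x0 u (mul_rep x0 (r.1, r.2.1), r.2.2))
  - right_rep (r.2.1, triv_rep x0 u (r.1, chart u u)).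

Lemma mul_rep_center x0 : mul_rep x0 (chart x0 x0, e0) = chart x0 x0.
Proof. by rewrite /mul_rep /= !chart_inv_center mulg1. Qed.

Lemma relative_rep_strict u x0 :
  strictly_differentiable (relative_rep u x0) (chart x0 x0, (e0, chart u u)).
Proof.
set r0 := (chart x0 x0, (e0, chart u u)).
have [_ sm _] := smooth_near_tangent finite_coordinates_rV2 (mul_rep_smooth x0).
have s1 : strictly_differentiable (fun r : E * (E * V) => r.1) r0 by exact: strict_fst.
have s2 : strictly_differentiable (fun r : E * (E * V) => r.2.1) r0.
  exact: (strict_comp (strict_snd r0) (strict_fst _)).
have s3 : strictly_differentiable (fun r : E * (E * V) => r.2.2) r0.
  exact: (strict_comp (strict_snd r0) (strict_snd _)).
have s4 : strictly_differentiable (fun r : E * (E * V) => mul_rep x0 (r.1, r.2.1)) r0.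
  exact: (strict_comp (strict_pair s1 s2) sm).
have s5 : strictly_differentiable
    (fun r : E * (E * V) => triv_rep x0 u (mul_rep x0 (r.1, r.2.1), r.2.2)) r0.
  apply: (strict_comp (strict_pair s4 s3) (g := triv_rep x0 u)).
  by rewrite /= mul_rep_center; exact: triv_rep_strict.
have s6 : strictly_differentiable
    (fun r : E * (E * V) => triv_rep x0 u (r.1, chart u u)) r0.
  exact: (strict_comp (strict_pair s1 (strict_cst _ r0)) (triv_rep_strict x0 u)).
apply: strict_sub.
  exact: (strict_comp (strict_pair s2 s5) (left_rep_strict _)).
exact: (strict_comp (strict_pair s2 s6) (right_rep_strict _)).
Qed.

End RelativeMotion.

Arguments left_rep {R n} G q.
Arguments right_rep {R n} G q.

Section Linearization.
Context {R : realType} {n : nat} {G : lieGroupType R n}.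
Context {V : normedModType R} {U : manifoldType V}.
Context (F : forall g : G, U -> tangent g).
Hypothesis C1F : C1_vf F.
Local Notation E := 'rV[R]_n.
Local Notation e0 := (chart (1%g : G) 1%g).
Implicit Types (x : G) (u : U).

Lemma relative_velocity0 u x : relative_velocity F u x (e0, chart u u) = 0.
Proof.
by rewrite /relative_velocity /= !chart_inv_center mulg1 left_rep1 right_rep1 subrr.
Qed.

Lemma relative_velocity_repE u x0 : exists A B,
  [/\ nbhs x0 A, nbhs e0 B & forall x z w, A x -> B z ->
     relative_velocity F u x (z, w) = relative_rep F u x0 (chart x0 x, (z, w))].
Proof.
have : nbhs (x0 * 1)%g (chart_dom x0).
  by rewrite mulg1; exact: chart_dom_nbhs (chart_dom_center x0).
move=> /(@mulg_cvg _ _ G x0 1%g) [[A B] [/= Ax B1] AB].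
exists (A `&` chart_dom x0), (chart_inv (1%g : G) @^-1` B); split.
- exact: filterI Ax (chart_dom_nbhs (chart_dom_center x0)).
- exact: chart_inv_near (chart_dom_center _) B1.
move=> x z w [Axx xD] Bz.
rewrite /relative_velocity /relative_rep /triv_rep /mul_rep /= !chart_inv_center.
by rewrite !chartK//; exact: (AB (x, _)).
Qed.

Lemma relative_velocity_diff u x0 :
  is_diff (e0, chart u u) (relative_velocity F u x0)
    (fun p => 'd (relative_rep F u x0) (chart x0 x0, (e0, chart u u)) (0, p)).
Proof.
have [dG _] := relative_rep_strict C1F u x0.
have [A [B [Ax Be AB]]] := relative_velocity_repE u x0.
apply: is_diff_near_eq (is_diff_partialr dG).
have : \forall p \near (e0, chart u u), B p.1 by exact: near_fst.
by apply: filterS => -[z w] /= Bz; rewrite AB//; exact: nbhs_singleton.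
Qed.

(** Strict differentiability of [relative_rep] is applied to two points with the
    same first coordinate; the relative velocity vanishes at the second one. *)
Lemma relative_velocity_linearization u x0 (e : R) : 0 < e ->
  \forall x \near x0 & p \near (e0, chart u u),
    `|relative_velocity F u x p
       - 'd (relative_velocity F u x0) (e0, chart u u) (p - (e0, chart u u))|
    <= e * `|p - (e0, chart u u)|.
Proof.
move=> ep; set p0 := (e0, chart u u).
have [_ /(_ e ep) [[A B] [/= NA NB] AB]] := relative_rep_strict C1F u x0.
have [dH ->] := relative_velocity_diff u x0.
have [A' [B' [A'x B'e AB']]] := relative_velocity_repE u x0.
move: NA NB => [[A1 A2] [/= NA1 NA2] A12] [[B1 B2] [/= NB1 NB2] B12].
exists ([set x | [/\ A' x, A1 (chart x0 x) & B1 (chart x0 x)]],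
        [set p | B' p.1 /\ A2 p]).
  split; last first.
    apply: filterI NA2; exact: near_fst.
  have N1 := chart_map_near (chart_dom_center x0) NA1.
  have N2 := chart_map_near (chart_dom_center x0) NB1.
  by near=> x; split; near: x.
move=> [x [z w]] [/= [A'xx A1x B1x] [B'z A2p]].
have H := AB ((chart x0 x, (z, w)), (chart x0 x, p0))
  (conj (A12 (_, _) (conj A1x A2p)) (B12 (_, _) (conj B1x (nbhs_singleton NB2)))).
move: H; rewrite /= -(AB' x z w A'xx B'z).
rewrite -(AB' x e0 (chart u u) A'xx (nbhs_singleton B'e)) relative_velocity0 subr0.
rewrite (_ : (chart x0 x, (z, w)) - (chart x0 x, p0) = (0, (z, w) - p0)); last first.
  by apply: injective_projections; rewrite /= ?subrr.
have -> // : `|(0 : E, (z, w) - p0)| = `|(z, w) - p0|.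
by rewrite prod_normE /= normr0; apply/max_idPr.
Unshelve. all: by end_near. Qed.

End Linearization.

Section Derivatives.
Context {R : realType} {n : nat} {G : lieGroupType R n}.
Local Notation E := 'rV[R]_n.
Local Notation e0 := (chart (1%g : G) 1%g).
Implicit Types (x : G).

Lemma TL_is_diff x :
  is_diff e0 (fun q => chart x (x * chart_inv (1%g : G) q)%g) (TL x).
Proof.
have [dm _ _] := smooth_near_tangent finite_coordinates_rV2 (mul_rep_smooth x).
have dmx := nbhs_singleton dm.
have H : is_diff e0 (fun q => mul_rep x (chart x x, q))
    (fun v => 'd (mul_rep x) (chart x x, e0) (0, v)) by exact: is_diff_partialr.
have {}H : is_diff e0 (fun q => chart x (x * chart_inv (1%g : G) q)%g)
    (fun v => 'd (mul_rep x) (chart x x, e0) (0, v)).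
  apply: is_diff_near_eq H; near=> q.
  by rewrite /mul_rep /= chart_inv_center.
have [dF Ef] := H.
apply: DiffDef; first exact: dF.
by rewrite /TL /tangent_map /mdiff mulg1.
Unshelve. all: by end_near. Qed.

Lemma TL1 xi : TL (1%g : G) xi = xi.
Proof.
have : is_diff e0 (fun q => chart 1%g (1 * chart_inv (1%g : G) q)%g) id.
  apply: is_diff_near_eq (is_diff_id e0).
  apply: filterS (chart_near (chart_dom_center (1%g : G))) => q [_ Hq].
  by rewrite mul1g Hq.
by move=> /(is_diff_unique (TL_is_diff 1%g))/(_ xi).
Qed.

(** Both sides differentiate q |-> x * q at the identity; the right one does it
    through the chart at [x]. *)
Lemma left_rep_vf_near (eta : lie_algebra G) : \forall z \near e0,
  left_rep G (z, eta) = vf_rep (fun g : G => TL g eta) 1%g z.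
Proof.
have N1 : \forall z \near e0, differentiable (mul_rep (1%g : G)) (z, e0).
  exact: (near_partiall (mul_rep1_diff_near (G := G))).
have N2 := chart_near (chart_dom_center (1%g : G)).
apply: filterS2 N1 N2 => z dmz [xD Hz].
rewrite /vf_rep /mdiff /=; set x := chart_inv 1%g z in xD Hz *.
have H1 := is_diff_partialr dmz.
have H2 : is_diff e0 (fun q => (chart 1%g \o chart_inv x)
    (chart x (x * chart_inv (1%g : G) q)%g))
    (fun v => 'd (chart 1%g \o chart_inv x) (chart x x) (TL x v)).
  apply: is_diff_compose (TL_is_diff x) _.
  rewrite chart_inv_center mulg1; apply: differentiableP.
  exact: chart_transition_diff (chart_dom_center _) xD.
suff : is_diff e0 (fun q => mul_rep (1%g : G) (z, q))
    (fun v => 'd (chart 1%g \o chart_inv x) (chart x x) (TL x v)).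
  by move=> /(is_diff_unique H1)/(_ eta).
apply: is_diff_near_eq H2.
have : \forall q \near e0, chart_dom x (x * chart_inv (1%g : G) q)%g.
  apply: (chart_inv_near (P := fun y => chart_dom x (x * y)%g) (chart_dom_center _)).
  apply: mulg_cvgl; rewrite mulg1; exact: chart_dom_nbhs (chart_dom_center x).
by apply: filterS => q Hq; rewrite /mul_rep /= chartK.
Qed.

Lemma left_rep_is_diff eta :
  is_diff e0 (fun z => left_rep G (z, eta)) (fun v => 'd (left_rep G) (e0, eta) (v, 0)).
Proof. by have [dl _] := left_rep_strict (G := G) eta; exact: is_diff_partiall. Qed.

Lemma right_rep_is_diff xi :
  is_diff e0 (fun z => right_rep G (z, xi)) (fun v => 'd (right_rep G) (e0, xi) (v, 0)).
Proof. by have [dl _] := right_rep_strict (G := G) xi; exact: is_diff_partiall. Qed.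

(** Both are mixed second derivatives of the group law at the identity, taken in
    the two orders. *)
Lemma left_right_rep xi eta :
  'd (right_rep G) (e0, xi) (eta, 0) = 'd (left_rep G) (e0, eta) (xi, 0).
Proof.
have dT v : differentiable (fun y => 'd (mul_rep (1%g : G)) y v) (e0, e0).
  have [dt _] := mul_rep1_tangent (G := G) v.
  by have [] := is_diff_partiall dt.
have HL := is_diff_unique (left_rep_is_diff eta) (is_diff_partiall (dT (0, eta))).
have HR := is_diff_unique (right_rep_is_diff xi) (is_diff_partialr (dT (xi, 0))).
apply: (etrans (HR eta)); apply: (etrans _ (esym (HL xi))).
exact (second_diff_sym (0, eta) (xi, 0) (mul_rep1_diff_near (G := G)) dT).
Qed.

(** The bracket of left-invariant fields, with one of its two terms turned into
    the derivative of a right-invariant field by [left_right_rep]. *)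
Lemma ad_rep (xi eta : lie_algebra G) :
  ad xi eta = 'd (right_rep G) (e0, xi) (eta, 0)
              - 'd (left_rep G) (e0, xi) (eta, 0) :> E.
Proof.
have H (v w : lie_algebra G) : 'd (vf_rep (fun g : G => TL g v) 1%g) e0 w =
    'd (left_rep G) (e0, v) (w, 0).
  have := is_diff_near_eq (left_rep_vf_near v) (left_rep_is_diff v).
  by move=> [_ ->].
transitivity ('d (vf_rep (fun g : G => TL g eta) 1%g) e0 (TL (1%g : G) xi)
  - 'd (vf_rep (fun g : G => TL g xi) 1%g) e0 (TL (1%g : G) eta)); first by [].
have E1 : 'd (vf_rep (fun g : G => TL g eta) 1%g) e0 (TL (1%g : G) xi) =
    'd (right_rep G) (e0, xi) (eta, 0).
  apply: (etrans (H eta (TL (1%g : G) xi))).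
  apply: (etrans (congr1 (fun a : E => 'd (left_rep G) (e0, eta) (a, 0)) (TL1 xi))).
  exact: esym (left_right_rep xi eta).
have E2 : 'd (vf_rep (fun g : G => TL g xi) 1%g) e0 (TL (1%g : G) eta) =
    'd (left_rep G) (e0, xi) (eta, 0).
  apply: (etrans (H xi (TL (1%g : G) eta))).
  exact: (congr1 (fun a : E => 'd (left_rep G) (e0, xi) (a, 0)) (TL1 eta)).
exact: (congr2 (fun a b : E => a - b) E1 E2).
Qed.

End Derivatives.

Section LinearizedRelativeVelocity.
Context {R : realType} {n : nat} {G : lieGroupType R n}.
Context {V : normedModType R} {U : manifoldType V}.
Context (F : forall g : G, U -> tangent g).
Hypothesis C1F : C1_vf F.
Local Notation E := 'rV[R]_n.
Local Notation e0 := (chart (1%g : G) 1%g).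
Implicit Types (x : G) (u : U).

Lemma triv_vf_diffl x0 u :
  is_diff (chart x0 x0) (fun z => triv_vf F (chart_inv x0 z) u : E)
    (mdiff (fun g : G => triv_vf F g u) x0).
Proof.
have [dT _] := triv_rep_strict C1F x0 u.
have H : is_diff (chart x0 x0) (fun z => triv_vf F (chart_inv x0 z) u : E)
    (fun v => 'd (triv_rep F x0 u) (chart x0 x0, chart u u) (v, 0)).
  apply: is_diff_near_eq (is_diff_partiall dT); near=> z.
  by rewrite /triv_rep /= chart_inv_center.
have [dF _] := H; apply: DiffDef; [exact: dF|reflexivity].
Unshelve. all: by end_near. Qed.

Lemma triv_vf_diffr x0 u :
  is_diff (chart u u) (fun w => triv_vf F x0 (chart_inv u w) : E)
    (mdiff (fun v : U => triv_vf F x0 v) u).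
Proof.
have [dT _] := triv_rep_strict C1F x0 u.
have H : is_diff (chart u u) (fun w => triv_vf F x0 (chart_inv u w) : E)
    (fun v => 'd (triv_rep F x0 u) (chart x0 x0, chart u u) (0, v)).
  apply: is_diff_near_eq (is_diff_partialr dT); near=> z.
  by rewrite /triv_rep /= chart_inv_center.
have [dF _] := H; apply: DiffDef; [exact: dF|reflexivity].
Unshelve. all: by end_near. Qed.

Lemma translate_diff (W : normedModType R) (f df : E -> W) x0 :
  is_diff (chart x0 x0) f df ->
  is_diff e0 (fun q => f (chart x0 (x0 * chart_inv (1%g : G) q)%g))
    (fun v => df (TL x0 v)).
Proof.
move=> Hf; apply: is_diff_compose (TL_is_diff x0) _.
by rewrite chart_inv_center mulg1.
Qed.

Lemma translate_near x0 : \forall q \near e0,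
  chart_inv x0 (chart x0 (x0 * chart_inv (1%g : G) q)%g) =
  (x0 * chart_inv (1%g : G) q)%g.
Proof.
have : \forall q \near e0, chart_dom x0 (x0 * chart_inv (1%g : G) q)%g.
  apply: (chart_inv_near (P := fun y => chart_dom x0 (x0 * y)%g) (chart_dom_center _)).
  by apply: mulg_cvgl; rewrite mulg1; exact: chart_dom_nbhs (chart_dom_center x0).
by apply: filterS => q Hq; rewrite chartK.
Qed.

Lemma triv_vf_translate x0 u :
  is_diff e0 (fun q => triv_vf F (x0 * chart_inv (1%g : G) q)%g u : E)
    (fun v => mdiff (fun g : G => triv_vf F g u) x0 (TL x0 v)).
Proof.
apply: is_diff_near_eq (translate_diff (triv_vf_diffl x0 u)).
by apply: filterS (translate_near x0) => q ->.
Qed.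

Lemma relative_velocity_diffr u x0 (dw : V) :
  'd (relative_velocity F u x0) (e0, chart u u) (0, dw) =
  mdiff (fun v : U => triv_vf F x0 v) u dw.
Proof.
have [dH _] := relative_velocity_diff C1F u x0.
have H : is_diff (chart u u) (fun w => relative_velocity F u x0 (e0, w))
    (fun v => mdiff (fun v : U => triv_vf F x0 v) u v - 0).
  apply: is_diff_near_eq (is_diff_sub (triv_vf_diffr x0 u)
    (is_diff_cst (triv_vf F x0 u : E) (chart u u))).
  near=> w.
  by rewrite /relative_velocity /= chart_inv_center mulg1 left_rep1 right_rep1.
have := is_diff_unique (is_diff_partialr dH) H dw.
by rewrite subr0.
Unshelve. all: by end_near. Qed.

(** The derivative in the position splits into the change of the trivialized
    field, seen through [left_rep (e0, -) = id], and the change of the invariant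
    fields, which is minus the bracket. *)
Lemma relative_velocity_diffl u x0 (eta : lie_algebra G) :
  'd (relative_velocity F u x0) (e0, chart u u) (eta, 0) =
  mdiff (fun g : G => triv_vf F g u) x0 (TL x0 eta)
    - ad (triv_vf F x0 u) eta :> E.
Proof.
have [dH _] := relative_velocity_diff C1F u x0.
set xi := triv_vf F x0 u.
have [dl _] := left_rep_strict (G := G) xi.
pose dk v := mdiff (fun g : G => triv_vf F g u) x0 (TL x0 v) : E.
have H : is_diff e0 (fun z => relative_velocity F u x0 (z, chart u u))
    (fun v => 'd (left_rep G) (e0, xi) (v, dk v) - 'd (right_rep G) (e0, xi) (v, 0)).
  have kap0 : triv_vf F (x0 * chart_inv (1%g : G) e0)%g u = xi.
    by rewrite chart_inv_center mulg1.
  have HL : is_diff e0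
      (fun z => left_rep G (z, triv_vf F (x0 * chart_inv (1%g : G) z)%g u))
      (fun v => 'd (left_rep G) (e0, xi) (v, dk v)).
    have := is_diff_graph (g := left_rep G) (triv_vf_translate x0 u).
    by rewrite kap0; apply.
  apply: is_diff_near_eq (is_diff_sub HL (right_rep_is_diff xi)).
  by near=> z; rewrite /relative_velocity /= chart_inv_center.
have E1 := is_diff_unique (is_diff_partiall dH) H eta.
apply: (etrans E1).
have E2 : 'd (left_rep G) (e0, xi) (eta, dk eta) =
    'd (left_rep G) (e0, xi) (eta, 0) + dk eta.
  have -> : (eta, dk eta) = (eta, 0) + (0, dk eta) :> E * E.
    by apply: injective_projections; rewrite /= ?addr0 ?add0r.
  apply: (etrans (linearD ('d (left_rep G) (e0, xi)) _ _)); congr (_ + _).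
  apply: (partialr_id dl); near=> z; exact: left_rep1.
have E3 := ad_rep xi eta.
apply: (etrans (congr1 (fun a : E => a - 'd (right_rep G) (e0, xi) (eta, 0)) E2)).
apply: (etrans _ (esym (congr1 (fun a : E => dk eta - a) E3))).
exact: addr_subr_swap.
Unshelve. all: by end_near. Qed.

End LinearizedRelativeVelocity.

(** * The relative position of two curves *)

Section RelativeCurve.
Context {R : realType} {n : nat} {G : lieGroupType R n}.
Local Notation E := 'rV[R]_n.
Local Notation e0 := (chart (1%g : G) 1%g).
Local Notation m := (mul_rep (1%g : G)).
Implicit Types (x : G).

Definition inv1_rep (z : E) : E := chart (1%g : G) (chart_inv (1%g : G) z)^-1%g.

Lemma inv1_dom_near : \forall x \near (1%g : G), chart_dom (1%g : G) x^-1%g.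
Proof.
apply: (@lie_inv_continuous R n G 1%g); rewrite invg1.
exact: chart_dom_nbhs (chart_dom_center (1%g : G)).
Qed.

Lemma inv1_rep_diff : is_diff e0 inv1_rep (fun v => - v).
Proof.
apply: (inversion_diff (m := m)).
- exact: nbhs_singleton (mul_rep1_diff_near (G := G)).
- have [_ [dj _] _] := smooth_near_tangent (finite_coordinates_rV n)
    (inv_rep_smooth (1%g : G)).
  by move: dj; rewrite /inv_rep invg1.
- by rewrite /inv1_rep chart_inv_center invg1.
- exact: mul_rep1_el (chart_dom_center _).
- exact: mul_rep1_er (chart_dom_center _).
- apply: filterS2 (chart_near (chart_dom_center (1%g : G)))
    (chart_inv_near (chart_dom_center (1%g : G)) inv1_dom_near) => z [zD Hz] zV.
  by rewrite /mul_rep /inv1_rep /= (chartK _ _ zV) mulgV.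
Qed.

(** On this region the coordinate of a relative position moves with
    [relative_velocity], by [relative_curve_derivative]. *)
Definition relative_chart x : Prop :=
  [/\ chart_dom (1%g : G) x, differentiable m (e0, chart 1%g x)
    & differentiable m (chart 1%g x, e0)].

Lemma relative_chart_near : \forall x \near (1%g : G), relative_chart x.
Proof.
have c1 := chart_dom_center (1%g : G).
have N1 := chart_map_near c1 (near_partiall (mul_rep1_diff_near (G := G))).
have N2 := chart_map_near c1 (near_partialr (mul_rep1_diff_near (G := G))).
apply: filterS3 (chart_dom_nbhs c1) N1 N2 => x xD d1 d2.
exact: And3.
Qed.

Section Curves.
Context (D : set R).

Lemma curve_near (c : R -> G) t (P : G -> Prop) :
  c @ within D (nbhs t) --> c t -> (\forall x \near c t, P x) ->
  \forall s \near t, D s -> P (c s).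
Proof. by move=> cc HP; exact: (cc P HP). Qed.

Lemma curve_derivable_near (c : R -> G) t (P : G -> Prop) :
  curve_derivable D c t -> (\forall x \near c t, P x) ->
  \forall s \near t, D s -> P (c s).
Proof. by move=> [cc _]; exact: curve_near. Qed.

Lemma near_translate x y (P : G -> Prop) :
  (\forall a \near (x * y)%g, P a) -> \forall a \near y, P (x * a)%g.
Proof. exact: mulg_cvgl. Qed.

Lemma body_curve_derivative (c : R -> G) t : curve_derivable D c t ->
  has_derive_within D (fun s => chart 1%g ((c t)^-1 * c s)%g : E) t
    (left_triv (velocity D c t)).
Proof.
move=> cd; have [_ dc] := cd.
have [dL _] := nbhs_singleton (left_triv_near (c t)).
have H := has_derive_within_comp dL (derive_withinP dc).
have EL : 'd (chart (1%g : G) \o (fun y : G => ((c t)^-1 * y)%g) \o chart_inv (c t))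
    ((chart (c t) \o c) t) (derive_within D (chart (c t) \o c) t) =
    left_triv (velocity D c t).
  by rewrite /left_triv /tangent_map /mdiff mulVg.
rewrite EL in H.
apply: has_derive_within_near_eq H; last by rewrite /= chart_inv_center.
have := curve_derivable_near cd (chart_dom_nbhs (chart_dom_center (c t))).
apply: filterS => s Hs Ds.
exact (congr1 (fun x : G => chart (1%g : G) ((c t)^-1 * x)%g : E)
  (chartK _ _ (Hs Ds))).
Qed.

Lemma relative_curve_derivative (c d : R -> G) t :
  curve_derivable D c t -> curve_derivable D d t ->
  relative_chart ((c t)^-1 * d t)%g ->
  has_derive_within D (fun s => chart 1%g ((c s)^-1 * d s)%g : E) t
    (left_rep G (chart 1%g ((c t)^-1 * d t)%g, left_triv (velocity D d t))
     - right_rep G (chart 1%g ((c t)^-1 * d t)%g, left_triv (velocity D c t))).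
Proof.
move=> cd dd; set h := ((c t)^-1 * d t)%g => -[hD d1 d2].
set y := chart 1%g h in d1 d2 *.
have c1 := chart_dom_center (1%g : G).
have j0 : inv1_rep e0 = e0 by rewrite /inv1_rep chart_inv_center invg1.
have my : m (y, e0) = y.
  by rewrite /mul_rep /= chart_inv_center mulg1 chartK.
(* Near [t] the curve (c s)^-1 * d s is
   ((c t)^-1 * c s)^-1 * (h * ((d t)^-1 * d s)). *)
have HP := product_diff d1 d2 inv1_rep_diff j0 my.
pose a s : E := chart 1%g ((c t)^-1 * c s)%g.
pose b s : E := chart 1%g ((d t)^-1 * d s)%g.
have at0 : a t = e0 by rewrite /a mulVg.
have bt0 : b t = e0 by rewrite /b mulVg.
have dab := has_derive_within_pair (body_curve_derivative cd) (body_curve_derivative dd).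
have HP' : is_diff (a t, b t) (fun p => m (inv1_rep p.1, m (y, p.2)))
    (fun v => 'd m (e0, y) (0, 'd m (y, e0) (0, v.2)) - 'd m (e0, y) (v.1, 0)).
  by rewrite at0 bt0.
have H := has_derive_within_is_diff HP' dab.
have E1 := diff_mul_rep1l ('d m (y, e0) (0, left_triv (velocity D d t))) hD d1.
have {}H : has_derive_within D (fun s => m (inv1_rep (a s), m (y, b s))) t
   (left_rep G (y, left_triv (velocity D d t))
     - right_rep G (y, left_triv (velocity D c t))).
  move: H; rewrite /=.
  by rewrite [X in has_derive_within _ _ _ (X - _) -> _]E1.
have near1 (e : R -> G) : curve_derivable D e t -> forall P : G -> Prop,
    (\forall x \near (1%g : G), P x) -> \forall s \near t, D s -> P ((e t)^-1 * e s)%g.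
  move=> ed P HPn.
  apply: (curve_derivable_near (P := fun x => P ((e t)^-1 * x)%g) ed).
  by apply: near_translate; rewrite mulVg.
have N1 := near1 c cd _ (chart_dom_nbhs c1).
have N2 := near1 d dd _ (chart_dom_nbhs c1).
have N3 := near1 c cd _ inv1_dom_near.
have N4 : \forall s \near t, D s -> chart_dom (1%g : G) (h * ((d t)^-1 * d s))%g.
  apply: (near1 d dd (fun x => chart_dom (1%g : G) (h * x)%g)).
  by apply: near_translate; rewrite mulg1; exact: chart_dom_nbhs.
apply: has_derive_within_near_eq H; last first.
  by rewrite at0 bt0 j0 my /mul_rep /= chart_inv_center mul1g chartK.
near=> s => Ds.
have D1 : chart_dom (1%g : G) ((c t)^-1 * c s)%g by move: Ds; near: s.
have D2 : chart_dom (1%g : G) ((d t)^-1 * d s)%g by move: Ds; near: s.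
have D3 : chart_dom (1%g : G) (((c t)^-1 * c s)^-1)%g by move: Ds; near: s.
have D4 : chart_dom (1%g : G) (h * ((d t)^-1 * d s))%g by move: Ds; near: s.
rewrite /mul_rep /inv1_rep /a /b /= !(chartK _ _ D1) (chartK _ _ D2) (chartK _ _ D3).
rewrite (chartK _ _ hD) (chartK _ _ D4) /h; congr (chart _ _).
by rewrite invgM invgK !mulgA !mulgK.
Unshelve. all: by end_near. Qed.

End Curves.
End RelativeCurve.

Section Confinement.
Context {R : realType} {n : nat} {G : lieGroupType R n}.
Local Notation e0 := (chart (1%g : G) 1%g).

(** Open, so that a curve in it stays in it for nearby times. *)
Definition good_chart (x : G) := \forall a \near x, relative_chart a.

Lemma good_chart_relative x : good_chart x -> relative_chart x.
Proof. exact: nbhs_singleton. Qed.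

Lemma good_chart_open x : good_chart x -> \forall a \near x, good_chart a.
Proof. by move=> xN; exact: nbhs_interior. Qed.

Lemma good_chart1 : good_chart 1%g.
Proof. exact: relative_chart_near. Qed.

Lemma div_near (x y : G) (P : G -> Prop) :
  (\forall a \near (x^-1 * y)%g, P a) ->
  exists A B, [/\ nbhs x A, nbhs y B &
    forall a b, A a -> B b -> P (a^-1 * b)%g].
Proof.
move=> /(@mulg_cvg _ _ G x^-1%g y) [[A B] [/= Ax By] AB].
exists (fun a => A a^-1%g), B; split=> //.
  exact: (@lie_inv_continuous R n G x A Ax).
by move=> a b Aa Bb; exact: (AB (_, _) (conj Aa Bb)).
Qed.

(** The good region contains A * B for neighbourhoods A, B of 1.  While the
    coordinate of [h s] is at most [rho] the point [h s] lies in A, and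
    continuity puts (h s)^-1 * h t in B for [s] close to [t]; hence the limit
    point [h t] is still in the good region. *)
Lemma confinement : exists2 rho : R, 0 < rho &
  forall (D : set R) (h : R -> G) (t : R), 0 < t ->
    (forall s, 0 <= s < t -> D s) ->
    (forall P : G -> Prop, (\forall x \near h t, P x) ->
       \forall s \near t, D s -> P (h s)) ->
    (forall s, 0 <= s < t -> good_chart (h s) /\
       `|chart (1%g : G) (h s) - e0| <= rho) ->
    good_chart (h t).
Proof.
have : nbhs (1 * 1 : G)%g good_chart.
  by rewrite mulg1; exact: good_chart_open good_chart1.
move=> /(@mulg_cvg _ _ G 1%g 1%g) [[A B] [/= A1 B1] AB].
have /nbhs_normP[r /= r0 Hr] := chart_inv_near (chart_dom_center (1%g : G)) A1.
exists (r / 2); first by rewrite divr_gt0.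
move=> D h t t0 Dt hc Hs.
have : nbhs ((h t)^-1 * h t)%g B by rewrite mulVg.
move=> /div_near [A' [B' [A'h B'h AB']]].
have [s st /(_ (Dt s st)) As] := nbhs_before t0 (hc _ A'h).
have [/good_chart_relative [sD _ _] sr] := Hs s st.
have As1 : A (h s).
  rewrite -(chartK _ _ sD); apply: Hr; rewrite /= distrC.
  by rewrite (le_lt_trans sr)// ltr_pdivrMr// ltr_pMr// ltr1n.
have Bst := AB' _ _ As (nbhs_singleton B'h).
by have := AB (_, _) (conj As1 Bst); rewrite /= mulVKg.
Qed.

End Confinement.

Section MainAssembly.
Context {R : realType} {n : nat} {G : lieGroupType R n}.
Context {V : normedModType R} {U : manifoldType V}.
Context (T : R) (g0 : G) (F : forall x : G, U -> tangent x).
Context (g : U -> R -> G) (u : U).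
Hypothesis T0 : 0 < T.
Hypothesis C1F : C1_vf F.
Hypothesis gsol : \forall v \near u, is_solution F v g0 T (g v).
Local Notation E := 'rV[R]_n.
Local Notation e0 := (chart (1%g : G) 1%g).
Local Notation w0 := (chart u u).

Definition rel_pos (w : V) (t : R) : G := ((g u t)^-1 * g (chart_inv u w) t)%g.
Definition rel_coord (w : V) (t : R) : E := chart (1%g : G) (rel_pos w t).

Lemma mem_segment (t : R) : 0 <= t <= T -> t \in `[0, T].
Proof. by rewrite in_itv. Qed.

Lemma solution_curve v : is_solution F v g0 T (g v) ->
  forall t, 0 <= t <= T -> curve_derivable `[0, T] (g v) t /\
    left_triv (velocity `[0, T] (g v) t) = triv_vf F (g v t) v.
Proof. by move=> [_ gv] t /mem_segment /gv [cv ->]. Qed.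

Lemma solution_u : is_solution F u g0 T (g u).
Proof. exact: nbhs_singleton gsol. Qed.

Lemma rel_pos_near w t (P : G -> Prop) :
  is_solution F (chart_inv u w) g0 T (g (chart_inv u w)) -> 0 <= t <= T ->
  (\forall x \near rel_pos w t, P x) ->
  \forall s \near t, 0 <= s <= T -> P (rel_pos w s).
Proof.
move=> sw tT /div_near [A [B [Ag Bg AB]]].
have [cu _] := solution_curve solution_u tT; have [cw _] := solution_curve sw tT.
apply: filterS2 (curve_derivable_near cu Ag) (curve_derivable_near cw Bg).
by move=> s As Bs /mem_segment sT; apply: AB; [exact: As|exact: Bs].
Qed.

Lemma rel_coord_derivative w t :
  is_solution F (chart_inv u w) g0 T (g (chart_inv u w)) -> 0 <= t <= T ->
  good_chart (rel_pos w t) ->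
  has_derive_within `[0, T] (rel_coord w) t (relative_velocity F u (g u t) (rel_coord w t, w)).
Proof.
move=> sw tT /good_chart_relative rg; have [rD _ _] := rg.
have [cu vu] := solution_curve solution_u tT; have [cw vw] := solution_curve sw tT.
have := relative_curve_derivative cu cw rg.
rewrite vu vw /relative_velocity /= /rel_coord (chartK _ _ rD).
by rewrite /rel_pos mulVKg.
Qed.

Definition rel_lin (t : R) : {linear (E * V)%type -> E} :=
  'd (relative_velocity F u (g u t)) (e0, w0).

Lemma rel_lin_continuous t : 0 <= t <= T -> continuous (rel_lin t).
Proof.
move=> _; have [dH _] := relative_velocity_diff C1F u (g u t).
exact: diff_continuous.
Qed.

Lemma linearization_along t : 0 <= t <= T -> forall e : R, 0 < e ->
  \forall s \near t & p \near (e0, w0), 0 <= s <= T ->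
    `|relative_velocity F u (g u s) p - rel_lin t (p - (e0, w0))|
    <= e * `|p - (e0, w0)|.
Proof.
move=> tT e ep.
have [cu _] := solution_curve solution_u tT.
have [[A B] [/= Ac Bp] AB] := relative_velocity_linearization C1F u (g u t) ep.
exists ([set s | `[0, T]%classic s -> A (g u s)], B).
  by split=> //; exact: curve_derivable_near cu Ac.
move=> [s p] [/= As Bp'] /mem_segment sT.
exact: (AB (g u s, p) (conj (As sT) Bp')).
Qed.

Lemma solution_near : \forall w \near w0,
  is_solution F (chart_inv u w) g0 T (g (chart_inv u w)).
Proof. exact: (chart_inv_near (chart_dom_center u) gsol). Qed.

Lemma rel_pos_center t : rel_pos w0 t = 1%g.
Proof. by rewrite /rel_pos chart_inv_center mulVg. Qed.

Lemma rel_coord_bound : exists2 K : R, 0 < K & \forall w \near w0,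
  (rel_coord w 0 = e0 /\ forall t, 0 <= t <= T ->
    has_derive_within `[0, T] (rel_coord w) t (relative_velocity F u (g u t) (rel_coord w t, w))
    /\ `|rel_coord w t - e0| <= K * `|w - w0|) /\
  forall t, 0 <= t <= T -> chart_dom (1%g : G) (rel_pos w t).
Proof.
have [rho rho0 Hrho] := confinement (G := G).
have start w : is_solution F (chart_inv u w) g0 T (g (chart_inv u w)) -> rel_pos w 0 = 1%g.
  by move=> [gw _]; have [gu _] := solution_u; rewrite /rel_pos gw gu mulVg.
have [|K K0 HK] := gronwall_escape rel_lin_continuous linearization_along
  (A := fun w t => good_chart (rel_pos w t)) (y := rel_coord) rho0.
  apply: filterS solution_near => w sw _; split=> /=.
  - by rewrite (start w sw); exact: good_chart1.
  - by rewrite /rel_coord (start w sw).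
  - move=> t /andP[t0 tT] Hs.
    apply: (Hrho (fun s => 0 <= s <= T) (rel_pos w) t t0 _ _ Hs).
      by move=> s /andP[s0 st]; rewrite s0 (le_trans (ltW st)).
    by move=> P HP; apply: (rel_pos_near sw _ HP); rewrite (ltW t0).
  - move=> t /andP[t0 tT] gt; apply: (rel_pos_near (P := @good_chart R n G) sw).
      by rewrite t0 ltW.
    exact: good_chart_open.
  - by move=> t tT gt; exact: rel_coord_derivative.
exists K => //; apply: filterS2 solution_near HK => w sw /= HKw.
have rc0 : rel_coord w 0 = e0 by rewrite /rel_coord (start w sw).
have [ww0|ww0] := eqVneq w w0.
  subst w; split; last by move=> t _; rewrite rel_pos_center; exact: chart_dom_center.
  split=> // t tT; split; last by rewrite /rel_coord rel_pos_center !subrr !normr0 mulr0.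
  by apply: rel_coord_derivative => //; rewrite rel_pos_center; exact: good_chart1.
split.
  split=> // t tT; have [gt yt] := HKw ww0 t tT.
  by split; [exact: rel_coord_derivative|exact: yt].
by move=> t tT; have [/good_chart_relative[]] := HKw ww0 t tT.
Qed.

Section Costate.
Context (C : G -> R^o) (mu : R -> covector (1%g : G)).
Hypothesis smoothC : smooth_fun C.
Hypothesis adj : adjoint_equation F T u (g u) mu.
Hypothesis muT : forall eta, mu T eta = cotranslate (mdiff C (g u T)) eta.

(** The adjoint equation, with the body velocity replaced by the trivialized
    field and the bracket absorbed in the linearization. *)
Lemma costate_derivative t : 0 <= t <= T -> forall v : E,
  has_derive_within `[0, T] (fun s => mu s v : R^o) t (- mu t (rel_lin t (v, 0))).
Proof.
move=> tT v; have [dm Em] := adj (mem_segment tT) v.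
have := derive_withinP dm.
have [_ vu] := solution_curve solution_u tT.
suff -> : derive_within `[0, T] (fun s => mu s v) t = - mu t (rel_lin t (v, 0)) by [].
rewrite /ad_star /cotranslate /dual /body_velocity vu in Em.
rewrite /rel_lin.
apply: etrans _ (esym (congr1 (fun a : E => - mu t a) (relative_velocity_diffl C1F u (g u t) v))).
apply: etrans _ (esym (congr1 -%R (linearB (mu t) _ _))).
by move/eqP: Em; rewrite -addrA addrC addr_eq0 opprK => /eqP <-; rewrite opprB.
Qed.

Lemma terminal_is_diff : is_diff e0
  (fun z => C (g u T * chart_inv (1%g : G) z)%g) (mu T).
Proof.
have [S [So Sx] CS] := smoothC (g u T).
have [dC _] := CS 1%N.
have H := translate_diff (differentiableP (dC _ Sx)).
have H2 : is_diff e0 (fun z => C (g u T * chart_inv (1%g : G) z)%g)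
    (fun v => mdiff C (g u T) (TL (g u T) v)).
  by apply: is_diff_near_eq H; apply: filterS (translate_near (g u T)) => q /= ->.
have [dF Ef] := H2; apply: DiffDef; first exact: dF.
by rewrite Ef; apply/funext => v; rewrite muT.
Qed.

Lemma terminal_sensitivity :
  is_diff w0 ((fun v => C (g v T)) \o chart_inv u) (sensitivity T rel_lin mu).
Proof.
have [K K0 HK] := rel_coord_bound.
have HK1 : \forall w \near w0, rel_coord w 0 = e0 /\ forall t, 0 <= t <= T ->
    has_derive_within `[0, T] (rel_coord w) t (relative_velocity F u (g u t) (rel_coord w t, w))
    /\ `|rel_coord w t - e0| <= K * `|w - w0| by apply: filterS HK => w [].
have [dC EC] := terminal_is_diff.
have := adjoint_sensitivity T0 (finite_coordinates_rV n) rel_lin_continuous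
  linearization_along costate_derivative K0 HK1 dC EC.
apply: is_diff_near_eq; apply: filterS HK => w [_ /(_ T)].
rewrite ltW//= lexx => /(_ isT) rD.
by rewrite /rel_coord (chartK _ _ rD) /rel_pos mulVKg.
Qed.

End Costate.

End MainAssembly.

(** * Parameter sensitivity *)

(** The constraint xi - f(g, u) vanishes along a solution. *)
Lemma augmented_cost_solution (R : realType) (n : nat) (G : lieGroupType R n)
    (V : normedModType R) (U : manifoldType V) (T : R) (g0 : G) (C : G -> R^o)
    (F : forall x : G, U -> tangent x) (v : U) (c : R -> G)
    (mu : R -> covector (1%g : G)) :
  is_solution F v g0 T c -> augmented_cost F C T mu v c = C (c T).
Proof.
move=> [_ cv]; rewrite /augmented_cost.
rewrite (@eq_Rintegral _ _ _ lebesgue_measure `[0, T]%classic (fun=> 0)).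
  by rewrite Rintegral_cst// mul0r subr0.
move=> t; rewrite inE => tT.
have [_ vt] := cv t tT.
by rewrite /body_velocity vt subrr linear0.
Qed.

Theorem proposition3p4 (R : realType) (n : nat) (G : lieGroupType R n)
    (V : normedModType R) (U : manifoldType V)
    (T : R) (g0 : G) (C : G -> R^o) (F : forall x : G, U -> tangent x)
    (g : U -> R -> G) (u : U) (mu : R -> covector (1%g : G)) :
  0 < T ->
  smooth_fun C ->
  (forall v, smooth_vf (fun x => F x v)) ->
  C1_vf F ->
  (\forall v \near u, is_solution F v g0 T (g v)) ->
  adjoint_equation F T u (g u) mu ->
  (forall eta, mu T eta = cotranslate (mdiff C (g u T)) eta) ->
  let terminal := fun v => C (g v T) in
  let J := fun v => augmented_cost F C T mu v (g v) in
  [/\ mdifferentiable terminal u,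
      mdifferentiable J u
    & forall du : tangent u,
        mdiff terminal u du = mdiff J u du /\
        mdiff J u du =
          (\int[lebesgue_measure]_(t in `[0%R, T])
             mu t (mdiff (fun v => triv_vf F (g u t) v) u du))%R].
Proof.
move=> T0 smC _ C1F gsol adj muT terminal J.
have Hterm := terminal_sensitivity T0 C1F gsol smC adj muT.
have JE : \forall w \near chart u u,
    (terminal \o chart_inv u) w = (J \o chart_inv u) w.
  apply: (chart_inv_near (P := fun v => terminal v = J v) (chart_dom_center u)).
  by apply: filterS gsol => v gv; rewrite /J (augmented_cost_solution C mu gv).
have HJ := is_diff_near_eq JE Hterm.
have [dt Et] := Hterm; have [dJ EJ] := HJ.
split; [exact: dt|exact: dJ|move=> du].
have EJd : mdiff J u du = sensitivity T (rel_lin F g u) mu du.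
  exact: (congr1 (fun f : V -> R^o => f du) EJ).
split; rewrite EJd; first exact: (congr1 (fun f : V -> R^o => f du) Et).
apply: eq_Rintegral => t _.
exact: (congr1 (mu t) (relative_velocity_diffr C1F u (g u t) du)).
Qed.
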